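(* Let $s$ be a positive integer and let $\Omega_\mu(y_1,\dots,y_s)$ be an identically non-vanishing function of $s$ complex variables $y_1,\dots,y_s$ and of complex order $\mu$. Let $\mu,\psi\in\mathbb{C}$, let $a_l\ne0$ ($l=0,1,2,\dots$) be coefficients, and set $$\Lambda_{\mu,\psi}(y_1,\dots,y_s;\zeta):=\sum_{l=0}^{\infty}a_l\,\Omega_{\mu+\psi l}(y_1,\dots,y_s)\,\zeta^l .$$ For $p\in\mathbb{N}$ and $n\in\mathbb{N}_0$ set $$\Theta_{n,p}^{\mu,\psi}(x_1,\dots,x_r;y_1,\dots,y_s;\xi):=\sum_{l=0}^{[n/p]}a_l\,(\lambda)_{n-pl}\,{}^{(k)}E^{(r)}\left(\lambda+n-pl,\beta_{k+1},\dots,\beta_r;\gamma_1,\dots,\gamma_r;x_1,\dots,x_r\right)\Omega_{\mu+\psi l}(y_1,\dots,y_s)\frac{\xi^l}{(n-pl)!}.$$ Then, for every $p\in\mathbb{N}$, $$\sum_{n=0}^{\infty}\Theta_{n,p}^{\mu,\psi}\left(x_1,\dots,x_r;y_1,\dots,y_s;\frac{\eta}{t^p}\right)t^n$$ $$=\Lambda_{\mu,\psi}(y_1,\dots,y_s;\eta)\,(1-t)^{-\lambda}\,{}^{(k)}E^{(r)}\left(\lambda,\beta_{k+1},\dots,\beta_r;\gamma_1,\dots,\gamma_r;\frac{x_1}{(1-t)^{\rho}},\dots,\frac{x_k}{(1-t)^{\rho}},\frac{x_{k+1}}{1-t},\dots,\frac{x_r}{1-t}\right),$$ provided that each member of this identity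 exists.
   Context: $\mathbb{N}=\{1,2,\dots\}$, $\mathbb{N}_0=\mathbb{N}\cup\{0\}$, and $[\cdot]$ is the integer part. The Pochhammer symbol is $(\lambda)_\nu=\Gamma(\lambda+\nu)/\Gamma(\lambda)$ for $\lambda\in\mathbb{C}\setminus\{0,-1,-2,\dots\}$; moreover $(\lambda)_0=1$ and $(\lambda)_n=\lambda(\lambda+1)\cdots(\lambda+n-1)$ for every positive integer $n$ and every $\lambda\in\mathbb{C}$. Let $r\ge 1$ and $0\le k\le r$ be integers and $\rho\ge 0$. The multivariable hypergeometric function ${}^{(k)}E^{(r)}$ (depending on $\rho$) with complex parameters $\alpha,\beta_{k+1},\dots,\beta_r,\gamma_1,\dots,\gamma_r$ and complex variables $x_1,\dots,x_r$ is $${}^{(k)}E^{(r)}(\alpha,\beta_{k+1},\dots,\beta_r;\gamma_1,\dots,\gamma_r;x_1,\dots,x_r):=\sum_{m_1,\dots,m_r=0}^{\infty}(\alpha)_{\rho(m_1+\dots+m_k)+m_{k+1}+\dots+m_r}\frac{(\beta_{k+1})_{m_{k+1}}\cdots(\beta_r)_{m_r}}{(\gamma_1)_{m_1}\cdots(\gamma_r)_{m_r}}\frac{x_1^{m_1}}{m_1!}\cdots\frac{x_r^{m_r}}{m_r!},$$ where $\rho(\sqrt{|x_1|}+\dots+\sqrt{|x_k|})+|x_{k+1}|+\dots+|x_r|<1$. Here $\lambda\in\mathbb{C}$ and $|t|<1$, and powers of $1-t$ are principal. *)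

(* Defs.v *)
From mathcomp Require Import all_boot all_order all_algebra.
From mathcomp Require Import complex.
From mathcomp Require Import all_classical all_reals all_analysis.

Set Implicit Arguments.
Unset Strict Implicit.
Unset Printing Implicit Defensive.

Import Order.TTheory GRing.Theory Num.Theory.
Import numFieldNormedType.Exports.

Local Open Scope classical_set_scope.
Local Open Scope ring_scope.
Local Open Scope complex_scope.

(* The topology used on R[i] is that of the normed module R[i]^o over itself;
   Normc.normc is the modulus as an element of R. *)

Definition cexp (R : realType) (z : R[i]) : R[i] :=
  (expR (complex.Re z))%:C * (cos (complex.Im z) +i* sin (complex.Im z)).

(* Principal argument, in ]-pi, pi]; junk value at 0. *)
Definition carg (R : realType) (z : R[i]) : R :=
  let theta := acos (complex.Re z / Normc.normc z) in
  if 0 <= complex.Im z then theta else - theta.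

Definition clog (R : realType) (z : R[i]) : R[i] :=
  ln (Normc.normc z) +i* carg z.

Definition cpow (R : realType) (z a : R[i]) : R[i] := cexp (a * clog z).

Definition nonpos_int (R : realType) (z : R[i]) : Prop :=
  exists n : nat, z = - n%:R.

(* Gauss's limit n! n^z / (z (z+1) ... (z+n)), meaningful off the poles. *)
Definition Gamma (R : realType) (z : R[i]) : R[i] :=
  limn ((fun n : nat => n`!%:R * cpow n%:R z / \prod_(i < n.+1) (z + i%:R))
        : nat -> R[i]^o).

Definition pochn (R : realType) (a : R[i]) (n : nat) : R[i] :=
  \prod_(i < n) (a + i%:R).

(* The index rho (m_1 + ... + m_k) + m_(k+1) + ... + m_r is a real number: a
   natural index gives the finite product (for every a), any other index the
   quotient of Gamma values. *)
Definition poch (R : realType) (a : R[i]) (nu : R) : R[i] :=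
  if nu \is a Num.nat then pochn a (Num.truncn nu)
  else Gamma (a + nu%:C) / Gamma a.

Definition poch_defined (R : realType) (a : R[i]) (nu : R) : Prop :=
  nu \is a Num.nat \/ (~ nonpos_int a /\ ~ nonpos_int (a + nu%:C)).

Definition E_index (R : realType) (r k : nat) (rho : R) (m : 'I_r -> nat) : R :=
  rho * (\sum_(i < r | (i < k)%N) m i)%N%:R
  + (\sum_(i < r | (k <= i)%N) m i)%N%:R.

(* Indices are 0-based: i : 'I_r stands for the (i+1)-st variable, so the first
   group of variables is i < k.  The entries beta i with i < k are not used. *)
Definition E_term (R : realType) (r k : nat) (rho : R) (alpha : R[i])
    (beta gamma x : 'I_r -> R[i]) (m : 'I_r -> nat) : R[i] :=
  poch alpha (E_index k rho m)
  * ((\prod_(i < r | (k <= i)%N) pochn (beta i) (m i))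
     / \prod_(i < r) pochn (gamma i) (m i))
  * \prod_(i < r) (x i ^+ m i / (m i)`!%:R).

(* The multiple series is summed along the cubes {0, ..., n-1}^r; the order is
   immaterial under E_defined, where convergence is absolute. *)
Definition E (R : realType) (r k : nat) (rho : R) (alpha : R[i])
    (beta gamma x : 'I_r -> R[i]) : R[i] :=
  limn ((fun n : nat => \sum_(m : {ffun 'I_r -> 'I_n})
           E_term k rho alpha beta gamma x (fun i => m i : nat))
        : nat -> R[i]^o).

Definition E_abs_cvg (R : realType) (r k : nat) (rho : R) (alpha : R[i])
    (beta gamma x : 'I_r -> R[i]) : Prop :=
  cvgn (fun n : nat => \sum_(m : {ffun 'I_r -> 'I_n})
          Normc.normc (E_term k rho alpha beta gamma x (fun i => m i : nat))).

Definition E_region (R : realType) (r k : nat) (rho : R)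
    (x : 'I_r -> R[i]) : Prop :=
  rho * (\sum_(i < r | (i < k)%N) Num.sqrt (Normc.normc (x i)))
  + \sum_(i < r | (k <= i)%N) Normc.normc (x i) < 1.

(* The value of E at x exists: all coefficients make sense, x lies in the
   prescribed region, and x is in the domain of convergence of the power
   series, i.e. the series converges absolutely at x and slightly beyond, at
   some d x with d > 1.  Since the region is open and the series converges
   absolutely throughout it when rho <= 2, the last clause has content only
   for rho > 2, where the region inequality alone does not ensure
   convergence. *)
Definition E_defined (R : realType) (r k : nat) (rho : R) (alpha : R[i])
    (beta gamma x : 'I_r -> R[i]) : Prop :=
  [/\ forall i, ~ nonpos_int (gamma i),
      forall m : 'I_r -> nat, poch_defined alpha (E_index k rho m),
      E_region k rho x
    & exists2 d : R, 1 < d &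
        E_abs_cvg k rho alpha beta gamma (fun i => d%:C * x i)].

Definition rescale (R : realType) (r k : nat) (rho : R) (t : R[i])
    (x : 'I_r -> R[i]) (i : 'I_r) : R[i] :=
  if (i < k)%N then x i / cpow (1 - t) rho%:C else x i / (1 - t).

Definition Lambda_term (R : realType) (s : nat) (a : nat -> R[i])
    (Omega : R[i] -> ('I_s -> R[i]) -> R[i]) (mu psi : R[i])
    (y : 'I_s -> R[i]) (zeta : R[i]) (l : nat) : R[i] :=
  a l * Omega (mu + psi * l%:R) y * zeta ^+ l.

Definition Lambda (R : realType) (s : nat) (a : nat -> R[i])
    (Omega : R[i] -> ('I_s -> R[i]) -> R[i]) (mu psi : R[i])
    (y : 'I_s -> R[i]) (zeta : R[i]) : R[i] :=
  limn (series (Lambda_term a Omega mu psi y zeta) : nat -> R[i]^o).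

Definition Theta (R : realType) (r k s : nat) (rho : R) (lambda : R[i])
    (beta gamma : 'I_r -> R[i]) (a : nat -> R[i])
    (Omega : R[i] -> ('I_s -> R[i]) -> R[i]) (mu psi : R[i])
    (n p : nat) (x : 'I_r -> R[i]) (y : 'I_s -> R[i]) (xi : R[i]) : R[i] :=
  \sum_(l < (n %/ p).+1)
    a l * pochn lambda (n - p * l)
    * E k rho (lambda + (n - p * l)%:R) beta gamma x
    * Omega (mu + psi * l%:R) y * (xi ^+ l / (n - p * l)`!%:R).

(* Main.v *)
Require Import Defs.
From mathcomp Require Import all_boot all_order all_algebra.
From mathcomp Require Import complex.
From mathcomp Require Import all_classical all_reals all_analysis.
From mathcomp Require Import ring lra.

Set Implicit Arguments.
Unset Strict Implicit.
Unset Printing Implicit Defensive.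

Import Order.TTheory GRing.Theory Num.Theory.
Import numFieldNormedType.Exports.
Local Open Scope classical_set_scope.
Local Open Scope ring_scope.
Local Open Scope complex_scope.

(** Write [A_l = a_l Omega_(mu + psi l) eta ^ l],
    [B_m = (lambda)_m / m! E (lambda + m; x)] and
    [F t = (1 - t) ^ (- lambda) E (lambda; rescale t x)]. After the substitution
    [xi = eta / t ^ p] the terms on the left are the convolution
    [c_n = \sum_(p l <= n) A_l B_(n - p l) t ^ (n - p l)]. Formally the series
    of the [B_m t ^ m] is [F t]: since
    [(lambda)_m (lambda + m)_nu = (lambda)_nu (lambda + nu)_m]
    ([pochn_mul_poch]), summing over [m] first produces, by the binomial series
    ([binomial_series]), the factor [(1 - t) ^ (- lambda - nu)] in the term of
    index [nu] of [E], and this factor is what the rescaling of the variables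
    amounts to ([E_term_rescale]). For small [t] all of this is absolutely
    convergent ([E_local_expansion]), and the identity is a Cauchy product.

    At the given [t], however, the series of the [B_m t ^ m] may diverge: for
    [r = 1] and [k = 0] the function [E (lambda; x / (1 - t))] usually has a
    singularity at [t = 1 - x], which may be closer to 0 than [t] although both
    [x] and [x / (1 - t)] are admissible. Only the convergence of the series of
    the [c_n] and of the [A_l] is given. So the identity is continued
    analytically instead ([product_by_continuation]). With [t] fixed, the power
    series [c (z)] of the [c_n] and [A (z ^ p)] are analytic for [|z| < 1] and
    [c (z) = A (z ^ p) F (t z)] near [z = 0]. The function [F] has a convergent
    expansion around every point [t0] at which the series of [E] converges with
    some room to spare ([rescaled_E_analytic]), and as only [|1 - t0|] matters
    for this ([normc_rescale_le]), it does so whenever [|t0| <= |t|] and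
    [|1 - t0|] is at least 1 or essentially at least [|1 - t|]. The straight
    segment from 0 to [t] may leave this region, but the segment from 0 to
    [- |t|] followed by the chord from [- |t|] to [t] stays in it
    ([chord_distance]). Continuation along this path
    ([analytic_zero_segment]), run for [s t] with [0 < s < 1], gives
    [c (s) = A (s ^ p) F (s t)]. Finally [s] tends to 1: the two power series
    converge at 1, so Abel's theorem ([abel_limit]) applies to them, and [F] is
    continuous at [t].

    All rearrangements are instances of one exchange theorem for double series
    ([csums_exchange]); a multiple series is made simple by grouping its terms
    into the shells between consecutive cubes ([shell_sum]). *)

(** * Complex series *)

Section ComplexSeries.
Variable R : realType.
Implicit Types (u v a b : nat -> R[i]) (l z h : R[i]).

Local Notation normc := (@Normc.normc R).
Local Notation Rec := (@complex.Re R).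
Local Notation Imc := (@complex.Im R).

Lemma normc_ge0 z : 0 <= normc z.
Proof. by case: z => x y; apply: sqrtr_ge0. Qed.

Lemma normcD_le (z w : R[i]) : normc (z + w) <= normc z + normc w.
Proof. exact: le_normcD. Qed.

Lemma normc_opp z : normc (- z) = normc z.
Proof. exact: normcN. Qed.

Lemma normcB_le (z w : R[i]) : normc (z - w) <= normc z + normc w.
Proof. by rewrite -(normc_opp w) normcD_le. Qed.

Lemma normcX z n : normc (z ^+ n) = normc z ^+ n.
Proof.
elim: n => [|n IH]; first by rewrite !expr0 Normc.normc1.
by rewrite !exprS Normc.normcM IH.
Qed.

Lemma normc_real (x : R) : normc x%:C = `|x|.
Proof. by rewrite /= expr0n /= addr0 sqrtr_sqr. Qed.

Lemma normc_nat n : normc n%:R = n%:R.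
Proof. by rewrite -(rmorph_nat (real_complex R)) normc_real ger0_norm. Qed.

Lemma normc_eq0 z : (normc z == 0) = (z == 0).
Proof.
by apply/eqP/eqP => [/Normc.eq0_normc //|->]; rewrite Normc.normc0.
Qed.

Lemma normc_gt0 z : (0 < normc z) = (z != 0).
Proof. by rewrite lt_neqAle normc_ge0 andbT eq_sym normc_eq0. Qed.

Lemma normc_sum (I : Type) (r : seq I) (P : pred I) (F : I -> R[i]) :
  normc (\sum_(i <- r | P i) F i) <= \sum_(i <- r | P i) normc (F i).
Proof.
elim/big_rec2: _ => [|i x z _ IH]; first by rewrite Normc.normc0.
by apply: le_trans (normcD_le _ _) _; rewrite lerD2l.
Qed.

Lemma normc_prod (I : Type) (r : seq I) (P : pred I) (F : I -> R[i]) :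
  normc (\prod_(i <- r | P i) F i) = \prod_(i <- r | P i) normc (F i).
Proof.
elim/big_rec2: _ => [|i x z _ IH]; first by rewrite Normc.normc1.
by rewrite Normc.normcM IH.
Qed.

Lemma Re_le_normc z : `|Rec z| <= normc z.
Proof.
case: z => x y /=; rewrite -sqrtr_sqr ler_wsqrtr //.
by rewrite lerDl sqr_ge0.
Qed.

Lemma Im_le_normc z : `|Imc z| <= normc z.
Proof.
case: z => x y /=; rewrite -sqrtr_sqr ler_wsqrtr //.
by rewrite lerDr sqr_ge0.
Qed.

Lemma normc_le_ReIm z : normc z <= `|Rec z| + `|Imc z|.
Proof.
case: z => x y /=.
rewrite -[leRHS]ger0_norm ?addr_ge0 // -sqrtr_sqr ler_wsqrtr //.
by rewrite sqrrD !real_normK ?num_real // lerD2r lerDl mulrn_wge0 ?mulr_ge0.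
Qed.

Lemma cvgc_normP u l :
  ((u : nat -> R[i]^o) @ \oo --> (l : R[i]^o)) <->
  (forall e : R, 0 < e -> \forall n \near \oo, normc (u n - l) < e).
Proof.
split=> [/cvgrPdist_lt ul e e0|ul].
  have := ul e%:C; rewrite ltcR => /(_ e0); apply: filterS => n.
  by rewrite distrC ltcR.
apply/cvgrPdist_lt => -[e e'] /=; rewrite ltcE /= => /andP[/eqP -> e0].
have := ul e e0; apply: filterS => n.
by rewrite distrC -ltcR.
Qed.

Lemma cvgc_ReIm u l :
  (Rec \o u) @ \oo --> Rec l ->
  (Imc \o u) @ \oo --> Imc l ->
  (u : nat -> R[i]^o) @ \oo --> (l : R[i]^o).
Proof.
move=> /cvgrPdist_lt ur /cvgrPdist_lt ui; apply/cvgc_normP => e e0.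
have e20 : 0 < e / 2 by rewrite divr_gt0.
near=> n.
apply: le_lt_trans (normc_le_ReIm _) _; rewrite [e]splitr.
have nr : `|Rec l - (Rec \o u) n| < e / 2.
  by near: n; exact: ur.
have ni : `|Imc l - (Imc \o u) n| < e / 2.
  by near: n; exact: ui.
rewrite distrC in nr; rewrite distrC in ni.
rewrite !raddfB /=; exact: ltrD.
Unshelve. all: by end_near. Qed.

Lemma cvgc_unique u (l l' : R[i]) :
  (u : nat -> R[i]^o) @ \oo --> (l : R[i]^o) ->
  (u : nat -> R[i]^o) @ \oo --> (l' : R[i]^o) -> l = l'.
Proof. exact: (@cvg_unique R[i]^o (@norm_hausdorff _ R[i]^o)). Qed.

Lemma cvgc_lim u l :
  (u : nat -> R[i]^o) @ \oo --> (l : R[i]^o) ->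
  limn (u : nat -> R[i]^o) = l.
Proof. exact: (@cvg_lim R[i]^o (@norm_hausdorff _ R[i]^o)). Qed.

Lemma cvgc_normc_le u l (K : R) :
  (u : nat -> R[i]^o) @ \oo --> (l : R[i]^o) ->
  (forall n, normc (u n) <= K) -> normc l <= K.
Proof.
move=> /cvgc_normP ul uK; apply/ler_addgt0Pr => e e0.
have [n un] : exists n, normc (u n - l) < e.
  by have [n _ /(_ n (leqnn n)) ?] := ul e e0; exists n.
rewrite -[l](subKr (u n)).
by apply: le_trans (normcB_le _ _) _; rewrite lerD ?uK // ltW.
Qed.

Lemma sum_ord_widen (F : nat -> R) m n :
  (forall i, 0 <= F i) -> (m <= n)%N -> \sum_(i < m) F i <= \sum_(i < n) F i.
Proof.
move=> F0 mn; rewrite -(subnKC mn) big_split_ord /= lerDl.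
by apply: sumr_ge0.
Qed.

Lemma cvgc_cst l : ((fun=> l) : nat -> R[i]^o) @ \oo --> (l : R[i]^o).
Proof. exact: cvg_cst. Qed.
#[global] Arguments cvgc_cst l [t] _.

Lemma cvgcM u v (l m : R[i]) :
  (u : nat -> R[i]^o) @ \oo --> (l : R[i]^o) ->
  (v : nat -> R[i]^o) @ \oo --> (m : R[i]^o) ->
  ((fun n => u n * v n) : nat -> R[i]^o) @ \oo --> (l * m : R[i]^o).
Proof. exact: (@cvgM R[i]). Qed.

Lemma cvgc_near_eq (u v : nat -> R[i]) (l : R[i]) :
  (\forall n \near \oo, u n = v n) ->
  (u : nat -> R[i]^o) @ \oo --> (l : R[i]^o) ->
  (v : nat -> R[i]^o) @ \oo --> (l : R[i]^o).
Proof.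
move=> uv /cvgc_normP ul; apply/cvgc_normP => e e0.
by apply: filterS2 uv (ul e e0) => n <-.
Qed.

Definition csums u l := (series u : nat -> R[i]^o) @ \oo --> (l : R[i]^o).

(** Absolute convergence with an explicit bound: the bound, unlike the sum, can
    be carried through rearrangements and compared term by term. *)
Definition abs_bounded u (K : R) :=
  forall n, \sum_(i < n) normc (u i) <= K.

Lemma csums_unique u (l l' : R[i]) : csums u l -> csums u l' -> l = l'.
Proof. exact: cvgc_unique. Qed.

Lemma csums_ext u v l : u =1 v -> csums u l -> csums v l.
Proof. by move=> /funext ->. Qed.

Lemma csums_normP u l :
  csums u l <-> (forall e : R, 0 < e ->
    \forall n \near \oo, normc (\sum_(i < n) u i - l) < e).
Proof.
rewrite /csums cvgc_normP; split=> H e e0; apply: filterS (H e e0) => n;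
  by rewrite /series /= big_mkord.
Qed.

Lemma csumsZ (c : R[i]) u l : csums u l -> csums (fun n => c * u n) (c * l).
Proof.
move=> ul; rewrite /csums.
have -> : series (fun n => c * u n) = (fun n => c * series u n).
  by apply/funext => n; rewrite /series /= mulr_sumr.
exact: (@cvgM R[i] _ _ _ (fun=> c) _ _ _ (cvg_cst _) ul).
Qed.

#[global] Arguments csumsZ c [u l] _.

Lemma csumsB u v (l l' : R[i]) :
  csums u l -> csums v l' -> csums (fun n => u n - v n) (l - l').
Proof.
move=> ul vl; rewrite /csums.
have -> : series (fun n => u n - v n) = (fun n => series u n - series v n).
  by apply/funext => n; rewrite /series /= sumrB.
exact: (@cvgB R[i] R[i]^o _ _ _ _ _ _ _ ul vl).
Qed.

Lemma csums_finite u N :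
  (forall n, (N <= n)%N -> u n = 0) -> csums u (\sum_(i < N) u i).
Proof.
move=> u0; apply/csums_normP => e e0; exists N => // n /= Nn.
rewrite -(subnKC Nn) big_split_ord /= [X in _ + X - _]big1 ?addr0 ?subrr.
  by rewrite Normc.normc0.
by move=> i _; rewrite u0 // leq_addr.
Qed.

Lemma csums_sum (I : Type) (r : seq I) (P : pred I) (f : I -> nat -> R[i])
    (g : I -> R[i]) :
  (forall i, P i -> csums (f i) (g i)) ->
  csums (fun n => \sum_(i <- r | P i) f i n) (\sum_(i <- r | P i) g i).
Proof.
move=> fg; elim: r => [|i r IH].
  rewrite big_nil; have := @csums_finite (fun=> 0) 0%N (fun _ _ => erefl).
  by rewrite big_ord0; apply: csums_ext => n; rewrite big_nil.
rewrite big_cons; case: ifPn => Pi; last first.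
  by apply: csums_ext IH => n; rewrite big_cons (negPf Pi).
have := csumsB (fg _ Pi) (csumsZ (-1) IH).
rewrite mulN1r opprK; apply: csums_ext => n.
by rewrite mulN1r opprK big_cons Pi.
Qed.

Lemma csums_shift u l k :
  csums (fun n => u (n + k)%N) l -> csums u (\sum_(i < k) u i + l).
Proof.
move=> /csums_normP ul; apply/csums_normP => e e0.
have [N _ NP] := ul e e0; exists (N + k)%N => // n /= Nn.
have kn : (k <= n)%N by rewrite (leq_trans _ Nn) // leq_addl.
rewrite -(subnKC kn) big_split_ord /=.
have -> : \sum_(i < n - k) u (k + i)%N = \sum_(i < n - k) u (i + k)%N.
  by apply: eq_bigr => i _; rewrite addnC.
rewrite (_ : _ - _ = \sum_(i < n - k) u (i + k)%N - l); last by ring.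
by apply: NP => /=; rewrite leq_subRL // addnC.
Qed.

Lemma abs_bounded_le u v K :
  (forall n, normc (u n) <= normc (v n)) -> abs_bounded v K -> abs_bounded u K.
Proof. by move=> uv vK n; apply: le_trans (vK n); apply: ler_sum. Qed.

Lemma abs_boundedZ (c : R[i]) u K :
  abs_bounded u K -> abs_bounded (fun n => c * u n) (normc c * K).
Proof.
move=> uK n; under eq_bigr do rewrite Normc.normcM.
by rewrite -mulr_sumr ler_wpM2l // normc_ge0.
Qed.

#[global] Arguments abs_boundedZ c [u K] _ n.

Lemma bounded_series_cvg (w : nat -> R) (u : nat -> R[i]) (K : R) :
  (forall n, `|w n| <= normc (u n)) -> abs_bounded u K -> cvgn (series w).
Proof.
move=> wu uK; apply: normed_cvg.
change (cvgn (series (fun n => `|w n|))); apply: nondecreasing_is_cvgn.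
  by apply: nondecreasing_series => n _ _; apply: normr_ge0.
exists K => _ [n _ <-]; apply: le_trans (uK n); rewrite /series /= big_mkord.
by apply: ler_sum.
Qed.

Lemma abs_bounded_csums u K : abs_bounded u K -> exists l, csums u l.
Proof.
move=> uK.
have cr : cvgn (series (Rec \o u)).
  by apply: bounded_series_cvg uK => n; apply: Re_le_normc.
have ci : cvgn (series (Imc \o u)).
  by apply: bounded_series_cvg uK => n; apply: Im_le_normc.
exists (limn (series (Rec \o u)) +i* limn (series (Imc \o u))).
apply: cvgc_ReIm => /=.
  have -> // : Rec \o series u = series (Rec \o u).
  by apply/funext => n; rewrite /series /= raddf_sum.
have -> // : Imc \o series u = series (Imc \o u).
by apply/funext => n; rewrite /series /= raddf_sum.
Qed.

Lemma csums_normc_le u l K : abs_bounded u K -> csums u l -> normc l <= K.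
Proof.
move=> uK ul; apply: (cvgc_normc_le ul) => n.
rewrite /series /= big_mkord.
exact: le_trans (normc_sum _ _ _) (uK n).
Qed.

Lemma abs_bounded_sum u K N (l : R[i]) :
  (forall n, \sum_(i < n) normc (u (N + i)%N) <= K) ->
  csums u l -> normc (\sum_(i < N) u i - l) <= K.
Proof.
move=> uK ul; rewrite -normc_opp opprB.
have [l' ul'] : exists l', csums (fun i => u (i + N)%N) l'.
  apply: (@abs_bounded_csums _ K) => n.
  by under eq_bigr do rewrite addnC; apply: uK.
rewrite (csums_unique ul (csums_shift ul')) addrAC subrr add0r.
apply: csums_normc_le ul' => n.
by under eq_bigr do rewrite addnC; apply: uK.
Qed.

(** The partial sums of the row sums approach the square partial sums: both
    differ by at most the mass lying outside the square, which is as small as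
    one wants because the masses of the squares increase to a supremum. *)
Lemma rows_minus_square (f : nat -> nat -> R[i]) (K : R) (g : nat -> R[i]) :
  (forall m n, \sum_(i < m) \sum_(j < n) normc (f i j) <= K) ->
  (forall i, csums (f i) (g i)) ->
  forall e : R, 0 < e -> \forall N \near \oo,
    normc (\sum_(i < N) \sum_(j < N) f i j - \sum_(i < N) g i) < e.
Proof.
move=> fK fg e e0.
pose S N := \sum_(i < N) \sum_(j < N) normc (f i j).
have Smono m n M N : (m <= M)%N -> (n <= N)%N ->
    \sum_(i < m) \sum_(j < n) normc (f i j) <=
    \sum_(i < M) \sum_(j < N) normc (f i j).
  move=> mM nN.
  apply: le_trans (_ : \sum_(i < M) \sum_(j < n) normc (f i j) <= _).
    apply: (@sum_ord_widen (fun i => \sum_(j < n) normc (f i j))) => // i.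
    by apply: sumr_ge0 => j _; apply: normc_ge0.
  apply: ler_sum => i _.
  apply: (@sum_ord_widen (fun j => normc (f i j))) => // j.
  exact: normc_ge0.
have S0 : has_sup (range S).
  split; first by exists (S 0%N), 0%N.
  by exists K => _ [n _ <-]; apply: fK.
have [_ [N0 _ <-] NS] := sup_adherent e0 S0.
exists N0 => // N /= N0N; rewrite -sumrB.
apply: (@le_lt_trans _ _ (sup (range S) - S N)); last first.
  rewrite ltrBlDr -ltrBlDl; apply: lt_le_trans NS _.
  exact: Smono.
rewrite -normc_opp -sumrN.
under eq_bigr do rewrite opprB.
(* all the row remainders at once form one absolutely bounded series *)
have rowsum : csums (fun j => \sum_(i < N) f i j) (\sum_(i < N) g i).
  by apply: csums_sum => i _; apply: fg.
rewrite sumrB exchange_big /= -normc_opp opprB.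
apply: abs_bounded_sum rowsum => n; rewrite lerBrDl.
apply: (@le_trans _ _ (\sum_(i < N) \sum_(j < N + n) normc (f i j))).
  rewrite /S [leLHS]addrC exchange_big /= [leRHS]exchange_big /=.
  rewrite [leRHS]big_split_ord /= [leLHS]addrC.
  by rewrite lerD2l; apply: ler_sum => j _; apply: normc_sum.
apply: le_trans (_ : S (N + n)%N <= _).
  by apply: Smono => //; exact: leq_addr.
by apply: ub_le_sup; [case: S0 | exists (N + n)%N].
Qed.

(** Multiplying each row by the phase that makes its sum nonnegative turns the
    sum of the moduli of the row sums into the sum of a single series. *)
Lemma row_sums_abs_bounded (f : nat -> nat -> R[i]) (K : R) (g : nat -> R[i]) :
  (forall m n, \sum_(i < m) \sum_(j < n) normc (f i j) <= K) ->
  (forall i, csums (f i) (g i)) -> abs_bounded g K.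
Proof.
move=> fK fg.
move=> m.
pose G := \sum_(i < m) (normc (g i))%:C.
have rs : csums (fun j => \sum_(i < m)
    (if g i == 0 then 0 else (normc (g i))%:C / g i) * f i j) G.
  apply: csums_sum => i _.
  have := csumsZ (if g i == 0 then 0 else (normc (g i))%:C / g i) (fg i).
  case: eqP => [->|/eqP g0]; first by rewrite mul0r Normc.normc0.
  by rewrite divfK.
have -> : \sum_(i < m) normc (g i) = normc G.
  rewrite /G -rmorph_sum normc_real ger0_norm // sumr_ge0 // => i _.
  exact: normc_ge0.
apply: csums_normc_le rs => n.
apply: le_trans (fK m n); rewrite exchange_big /=; apply: ler_sum => j _.
apply: le_trans (normc_sum _ _ _) _; apply: ler_sum => i _.
rewrite Normc.normcM; case: eqP => [_|/eqP g0].
  by rewrite Normc.normc0 mul0r normc_ge0.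
rewrite Normc.normcM Normc.normcV normc_real ger0_norm ?normc_ge0 //.
by rewrite mulfV ?normc_eq0 // mul1r.
Qed.

(** Fubini's theorem for double series: the partial sums of the row sums and of
    the column sums are both close to the same square partial sums. Cauchy
    products, recentring of power series and the expansion of [E] are all
    instances of it. *)
Lemma csums_exchange (f : nat -> nat -> R[i]) (K : R) (g h : nat -> R[i]) :
  (forall m n, \sum_(i < m) \sum_(j < n) normc (f i j) <= K) ->
  (forall i, csums (f i) (g i)) -> (forall j, csums (f^~ j) (h j)) ->
  exists l, csums g l /\ csums h l.
Proof.
move=> fK fg fh.
have fK' m n : \sum_(i < m) \sum_(j < n) normc (f j i) <= K.
  by rewrite exchange_big; apply: fK.
have gK := row_sums_abs_bounded fK fg.
have [l gl] := abs_bounded_csums gK.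
exists l; split => //; apply/csums_normP => e e0.
have e3 : 0 < e / 3 by rewrite divr_gt0.
near=> N.
have A : normc (\sum_(i < N) \sum_(j < N) f i j - \sum_(i < N) g i) < e / 3.
  by near: N; apply: rows_minus_square fK fg _ e3.
have B : normc (\sum_(i < N) \sum_(j < N) f j i - \sum_(i < N) h i) < e / 3.
  by near: N; apply: rows_minus_square fK' fh _ e3.
have C : normc (\sum_(i < N) g i - l) < e / 3.
  by near: N; move/csums_normP: gl; apply.
rewrite exchange_big /= in B.
set Q := \sum_(i < N) \sum_(j < N) f i j in A B.
rewrite (_ : _ - _ = (Q - \sum_(i < N) g i) - (Q - \sum_(i < N) h i)
                     + (\sum_(i < N) g i - l)); last by ring.
have := normcD_le ((Q - \sum_(i < N) g i) - (Q - \sum_(i < N) h i))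
  (\sum_(i < N) g i - l).
have := normcB_le (Q - \sum_(i < N) g i) (Q - \sum_(i < N) h i).
lra.
Unshelve. all: by end_near. Qed.

(** The rows of the double series are the shifted copies [a i * b (n - i)],
    taken to be 0 for [n < i]. *)
Lemma csums_cauchy_product a b (A B : R[i]) (Ka Kb : R) :
  abs_bounded a Ka -> abs_bounded b Kb -> csums a A -> csums b B ->
  abs_bounded (fun n => \sum_(i < n.+1) a i * b (n - i)%N) (Ka * Kb) /\
  csums (fun n => \sum_(i < n.+1) a i * b (n - i)%N) (A * B).
Proof.
move=> aK bK aA bB.
pose f i n := if (i <= n)%N then a i * b (n - i)%N else 0.
have Kb0 : 0 <= Kb by have := bK 0%N; rewrite big_ord0.
have fK m n : \sum_(i < m) \sum_(j < n) normc (f i j) <= Ka * Kb.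
  apply: le_trans (_ : \sum_(i < m) normc (a i) * Kb <= _); last first.
    by rewrite -mulr_suml ler_wpM2r.
  apply: ler_sum => i _.
  apply: le_trans (_ : \sum_(j < n) normc (f i (i + j)%N) <= _).
    have [ni|/ltnW i_n] := leqP n i.
      rewrite big1 ?sumr_ge0 // => j _; first exact: normc_ge0.
      by rewrite /f leqNgt (leq_trans (ltn_ord j) ni) Normc.normc0.
    have [q ->] : exists q, n = (i + q)%N by exists (n - i)%N; rewrite subnKC.
    rewrite big_split_ord /= big1 ?add0r => [|j _]; last first.
      by rewrite /f leqNgt ltn_ord Normc.normc0.
    apply: (@sum_ord_widen (fun j => normc (f i (i + j)%N))).
      by move=> j; apply: normc_ge0.
    exact: leq_addl.
  under eq_bigr do rewrite /f leq_addr addKn Normc.normcM.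
  by rewrite -mulr_sumr ler_wpM2l // normc_ge0.
have col n : csums (f^~ n) (\sum_(i < n.+1) a i * b (n - i)%N).
  have -> : \sum_(i < n.+1) a i * b (n - i)%N = \sum_(i < n.+1) f i n.
    by apply: eq_bigr => i _; rewrite /f -ltnS ltn_ord.
  by apply: csums_finite => i ni; rewrite /f leqNgt ni.
have row i : csums (f i) (a i * B).
  have := @csums_shift (f i) (a i * B) i; rewrite big1 ?add0r; last first.
    by move=> j _; rewrite /f leqNgt ltn_ord.
  apply; apply: csums_ext (csumsZ (a i) bB) => n.
  by rewrite /f leq_addl addnK.
split.
  move=> n; apply: le_trans (fK n n); rewrite exchange_big /=.
  apply: ler_sum => j _; apply: le_trans (normc_sum _ _ _) _.
  apply: le_trans (_ : \sum_(i < j.+1) normc (f i j) <= _).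
    by apply: ler_sum => i _; rewrite /f -ltnS ltn_ord.
  apply: (@sum_ord_widen (fun i => normc (f i j))) => // i.
  exact: normc_ge0.
have [l [gl hl]] := csums_exchange fK row col.
have <- // : l = A * B.
apply: csums_unique gl _; rewrite mulrC; apply: csums_ext (csumsZ B aA) => i.
by rewrite mulrC.
Qed.

End ComplexSeries.

(** * Power series, their continuation along a segment, and Abel's limit *)

Section PowerSeries.
Variable R : realType.
Implicit Types (a b c : nat -> R[i]) (z h l : R[i]) (G H : R[i] -> R[i]).

Local Notation normc := (@Normc.normc R).

Lemma pser_abs_bounded c (d K : R) h :
  abs_bounded (fun n => c n * d%:C ^+ n) K -> normc h <= d ->
  abs_bounded (fun n => c n * h ^+ n) K.
Proof.
move=> cK hd; apply: abs_bounded_le cK => n.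
have d0 : 0 <= d by apply: le_trans hd; apply: normc_ge0.
rewrite !Normc.normcM !normcX normc_real (ger0_norm d0).
by rewrite ler_wpM2l ?normc_ge0 // lerXn2r ?nnegrE ?normc_ge0.
Qed.

(** The remainder after the constant term has a factor [h]. *)
Lemma pser_near0 c (d K : R) h l :
  0 < d -> abs_bounded (fun n => c n * d%:C ^+ n) K -> normc h <= d ->
  csums (fun n => c n * h ^+ n) l -> normc (l - c 0%N) <= normc h / d * K.
Proof.
move=> d0 cK hd cl.
have -> : normc (l - c 0%N) = normc (\sum_(i < 1) c i * h ^+ i - l).
  by rewrite big_ord_recl big_ord0 addr0 expr0 mulr1 -normc_opp opprB.
apply: abs_bounded_sum cl => n.
apply: le_trans (_ :
    normc h / d * \sum_(i < n.+1) normc (c i * d%:C ^+ i) <= _).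
  rewrite big_ord_recl mulrDr ler_wpDl //.
    by rewrite !mulr_ge0 ?normc_ge0 ?invr_ge0 ?(ltW d0).
  rewrite mulr_sumr; apply: ler_sum => i _.
  rewrite !Normc.normcM !normcX normc_real (gtr0_norm d0) [leRHS]mulrCA.
  rewrite ler_wpM2l ?normc_ge0 // !exprS mulrA divfK ?gt_eqF //.
  by rewrite ler_wpM2l ?normc_ge0 // lerXn2r ?nnegrE ?normc_ge0 // ltW.
by rewrite ler_wpM2l // divr_ge0 ?normc_ge0 // ltW.
Qed.

(** Dividing by the first power of [h] that could carry a nonzero coefficient
    and letting [h] tend to 0 kills that coefficient. *)
Lemma pser_eq0 c (d K e : R) :
  0 < d -> 0 < e -> abs_bounded (fun n => c n * d%:C ^+ n) K ->
  (forall h, normc h < e -> csums (fun n => c n * h ^+ n) 0) ->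
  forall n, c n = 0.
Proof.
move=> d0 e0 cK c0 n; elim/ltn_ind: n => n IH.
have dn0 : 0 < d ^+ n by rewrite exprn_gt0.
pose K' := K / d ^+ n.
have bK : abs_bounded (fun i => c (n + i)%N * d%:C ^+ i) K'.
  move=> N; rewrite /K' ler_pdivlMr // mulr_suml.
  apply: le_trans (cK (n + N)%N); rewrite big_split_ord /= ler_wpDl //.
    by apply: sumr_ge0 => i _; apply: normc_ge0.
  apply: ler_sum => i _; rewrite !Normc.normcM !normcX normc_real gtr0_norm //.
  by rewrite exprD -mulrA [d ^+ n * _]mulrC.
have K'0 : 0 <= K' by have := bK 0%N; rewrite big_ord0.
have small (x : R) : 0 < x -> x < e -> x <= d -> normc (c n) <= x * (K' / d).
  move=> x0 xe xd.
  have nx : normc x%:C = x by rewrite normc_real gtr0_norm.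
  have xd' : normc x%:C <= d by rewrite nx.
  have [l bl] := abs_bounded_csums (pser_abs_bounded bK xd').
  have l0 : l = 0.
    have xn0 : x%:C ^+ n != 0 by rewrite expf_neq0 // fmorph_eq0 gt_eqF.
    apply: (mulfI xn0); rewrite mulr0.
    have cx : csums (fun i => c i * x%:C ^+ i) (0 + x%:C ^+ n * l).
      have -> : (0 : R[i]) = \sum_(i < n) c i * x%:C ^+ i.
        by rewrite big1 // => i _; rewrite IH ?mul0r.
      apply: csums_shift. apply: csums_ext (csumsZ (x%:C ^+ n) bl) => i.
      by rewrite addnC exprD; ring.
    rewrite add0r in cx; have xe' : normc x%:C < e by rewrite nx.
    exact: csums_unique cx (c0 _ xe').
  have := pser_near0 d0 bK xd' bl.
  rewrite l0 sub0r normc_opp addn0 nx => /le_trans -> //.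
  by rewrite -mulrA [_ * K']mulrC.
apply/eqP; rewrite -normc_eq0 eq_le normc_ge0 andbT.
apply/ler_addgt0Pr => y y0; rewrite add0r.
pose x := Num.min (Num.min (e / 2) d) (y / (K' / d + 1)).
have Kd0 : 0 <= K' / d by apply: divr_ge0 => //; apply: ltW.
have q0 : 0 < K' / d + 1 by rewrite ltr_wpDl.
have x0 : 0 < x by rewrite !lt_min divr_gt0 //= d0 divr_gt0.
apply: le_trans (small x x0 _ _) _.
- have e2 : e / 2 < e by rewrite ltr_pdivrMr // ltr_pMr // ltr1n.
  by apply: le_lt_trans e2; rewrite /x !ge_min lexx.
- by rewrite /x !ge_min lexx orbT.
apply: le_trans (_ : y / (K' / d + 1) * (K' / d) <= _).
  rewrite ler_wpM2r //.
  by rewrite /x ge_min lexx orbT.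
rewrite mulrAC ler_pdivrMr // ler_wpM2l ?(ltW y0) // lerDl.
exact: ler01.
Qed.

(** [G] is the sum of one absolutely convergent power series on a whole closed
    disc. Fixing the radius is what makes the continuation below a finite
    induction. *)
Definition analytic_on_disc G z (d : R) := exists c (K : R),
  abs_bounded (fun n => c n * d%:C ^+ n) K /\
  forall h, normc h <= d -> csums (fun n => c n * h ^+ n) (G (z + h)).

Lemma analytic_on_discB G H z d :
  analytic_on_disc G z d -> analytic_on_disc H z d ->
  analytic_on_disc (fun w => G w - H w) z d.
Proof.
move=> [a [K [aK aG]]] [b [L [bL bH]]].
exists (fun n => a n - b n), (K + L); split=> [n|h hd].
  apply: le_trans (lerD (aK n) (bL n)); rewrite -big_split /=.
  by apply: ler_sum => i _; rewrite mulrBl normcB_le.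
apply: csums_ext (csumsB (aG h hd) (bH h hd)) => n.
by rewrite mulrBl.
Qed.

Lemma analytic_on_discM G H z d : 0 <= d ->
  analytic_on_disc G z d -> analytic_on_disc H z d ->
  analytic_on_disc (fun w => G w * H w) z d.
Proof.
move=> d0 [a [K [aK aG]]] [b [L [bL bH]]].
pose c n := \sum_(i < n.+1) a i * b (n - i)%N.
have cE h n : \sum_(i < n.+1) (a i * h ^+ i) * (b (n - i)%N * h ^+ (n - i))
    = c n * h ^+ n.
  rewrite mulr_suml; apply: eq_bigr => i _.
  have -> : h ^+ n = h ^+ i * h ^+ (n - i) by rewrite -exprD subnKC // -ltnS.
  by ring.
have nd : normc d%:C <= d by rewrite normc_real ger0_norm.
exists c, (K * L); split=> [|h hd].
  have [H1 _] := csums_cauchy_product aK bL (aG _ nd) (bH _ nd).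
  by apply: abs_bounded_le H1 => n; rewrite cE.
have [_ H2] := csums_cauchy_product (pser_abs_bounded aK hd)
  (pser_abs_bounded bL hd) (aG _ hd) (bH _ hd).
by apply: csums_ext H2 => n; rewrite cE.
Qed.

(** Expanding [(z0 + h) ^+ n] by the binomial theorem and summing first over
    [n] recentres a power series; the double series is dominated by the given
    one at the radius [|z0| + d]. *)
Lemma pser_recenter G c (rad K : R) z0 (d : R) :
  0 < d -> normc z0 + d <= rad ->
  abs_bounded (fun n => c n * rad%:C ^+ n) K ->
  (forall z, normc z <= rad -> csums (fun n => c n * z ^+ n) (G z)) ->
  analytic_on_disc G z0 d.
Proof.
move=> d0 zd cK cG.
pose q n j : R[i] := c n * ('C(n, j)%:R * z0 ^+ (n - j)).
pose f h n j : R[i] := q n j * h ^+ j.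
have fK h : normc h <= d -> forall m n,
    \sum_(i < m) \sum_(j < n) normc (f h i j) <= K.
  move=> hd m n; apply: le_trans (cK m); apply: ler_sum => i _.
  apply: le_trans (_ : \sum_(j < n + i.+1) normc (f h i j) <= _).
    apply: (@sum_ord_widen _ (fun j => normc (f h i j))); last exact: leq_addr.
    by move=> j; apply: normc_ge0.
  rewrite addnC big_split_ord /= [X in _ + X]big1 ?addr0; last first.
    move=> j _; rewrite /f /q bin_small ?leq_addr //.
    by rewrite mul0r mulr0 mul0r Normc.normc0.
  rewrite Normc.normcM normcX normc_real.
  under eq_bigr do
    rewrite /f /q !Normc.normcM !normcX normc_nat -mulrA.
  rewrite -mulr_sumr ler_wpM2l ?normc_ge0 //.
  apply: le_trans (_ : (normc z0 + normc h) ^+ i <= _).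
    rewrite exprDn; apply: ler_sum => j _.
    by rewrite -mulr_natl; rewrite le_eqVlt; apply/orP; left; apply/eqP; ring.
  apply: lerXn2r; rewrite ?nnegrE ?addr_ge0 ?normc_ge0 //.
  apply: le_trans (ler_norm _); apply: le_trans zd; by rewrite lerD2l.
have row h i : csums (f h i) (c i * (z0 + h) ^+ i).
  have -> : c i * (z0 + h) ^+ i = \sum_(j < i.+1) f h i j.
    rewrite exprDn mulr_sumr; apply: eq_bigr => j _.
    by rewrite /f /q -mulr_natl; ring.
  by apply: csums_finite => j ij; rewrite /f /q bin_small // mul0r mulr0 mul0r.
have nd : normc d%:C <= d by rewrite normc_real gtr0_norm.
have colex j : exists s : R[i], csums (fun n => q n j) s.
  have [l fl] : exists l, csums ((f d%:C)^~ j) l.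
    apply: (@abs_bounded_csums _ _ K) => m.
    apply: le_trans (fK _ nd m j.+1); apply: ler_sum => i _.
    rewrite big_ord_recr /= lerDr sumr_ge0 // => k _; exact: normc_ge0.
  exists ((d%:C ^+ j)^-1 * l); apply: csums_ext (csumsZ _ fl) => n.
  by rewrite /f mulrC mulfK // expf_neq0 // fmorph_eq0 gt_eqF.
have [b bP] := boolp.choice colex.
have col h j : csums ((f h)^~ j) (b j * h ^+ j).
  rewrite mulrC; apply: csums_ext (csumsZ (h ^+ j) (bP j)) => n.
  by rewrite /f mulrC.
exists b, K; split=> [|h hd].
  apply: row_sums_abs_bounded (fun j => col d%:C j) => m n.
  by rewrite exchange_big /=; apply: fK.
have [l [gl hl]] := csums_exchange (fK h hd) (row h) (col h).
have <- // : l = G (z0 + h).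
apply: csums_unique gl (cG _ _); apply: le_trans zd.
by apply: le_trans (normcD_le _ _) _; rewrite lerD2l.
Qed.

Lemma analytic_zero_spread G z (d e : R) :
  0 < d -> 0 < e -> analytic_on_disc G z d ->
  (forall h, normc h < e -> G (z + h) = 0) ->
  forall h, normc h <= d -> G (z + h) = 0.
Proof.
move=> d0 e0 [c [K [cK cG]]] G0 h hd.
have c0 : forall n, c n = 0.
  apply: (pser_eq0 (e := Num.min e d) d0 _ cK); first by rewrite lt_min e0.
  move=> k; rewrite lt_min => /andP[ke kd].
  by rewrite -(G0 k ke); apply: cG; apply: ltW.
apply: csums_unique (cG h hd) _.
have := @csums_finite R (fun n => c n * h ^+ n) 0 _.
rewrite big_ord0; apply=> n _.  by rewrite c0 mul0r.
Qed.

(** Analytic continuation along a segment: the discs have a common radius, so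
    finitely many of them, each centred well inside the previous one, lead from
    one end to the other. *)
Lemma analytic_zero_segment G z0 z1 (d e : R) :
  0 < d -> 0 < e ->
  (forall x : R, 0 <= x <= 1 ->
     analytic_on_disc G (z0 + x%:C * (z1 - z0)) d) ->
  (forall h, normc h < e -> G (z0 + h) = 0) ->
  forall h, normc h <= d -> G (z1 + h) = 0.
Proof.
move=> d0 e0 an G0.
(* the steps are shorter than half the radius, so that each centre has a
   neighbourhood inside the preceding disc *)
pose N := (Num.truncn (normc (z1 - z0) / (d / 2))).+1.
have Nd : normc (z1 - z0) / N%:R < d / 2.
  rewrite ltr_pdivrMr ?ltr0n // mulrC -ltr_pdivrMr ?divr_gt0 //.
  by rewrite /N truncnS_gt // divr_ge0 ?normc_ge0 // ltW // divr_gt0.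
pose P j := z0 + (j%:R / N%:R : R)%:C * (z1 - z0).
have anP j : (j <= N)%N -> analytic_on_disc G (P j) d.
  move=> jN; apply: an; rewrite divr_ge0 ?ler0n //=.
  by rewrite ler_pdivrMr ?ltr0n // mul1r ler_nat.
have zero j : (j <= N)%N -> forall h, normc h <= d -> G (P j + h) = 0.
  elim: j => [|j IH] jN.
    apply: analytic_zero_spread d0 e0 (anP _ jN) _ => h he.
    by rewrite /P mul0r mul0r addr0 G0.
  have d20 : 0 < d / 2 by rewrite divr_gt0.
  apply: analytic_zero_spread d0 d20 (anP _ jN) _ => h hd.
  have -> : P j.+1 + h = P j + ((1 / N%:R : R)%:C * (z1 - z0) + h).
    by rewrite /P -natr1 mulrDl rmorphD /=; ring.
  apply: IH (ltnW jN) _ _; apply: le_trans (normcD_le _ _) _.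
  rewrite [leRHS]splitr lerD ?(ltW hd) //.
  by rewrite Normc.normcM normc_real ger0_norm ?divr_ge0 // mul1r mulrC ltW.
move=> h hd; have <- : P N = z1.
  by rewrite /P divff ?pnatr_eq0 // mul1r addrC subrK.
exact: zero.
Qed.

Lemma geometric_le (x : R) n : 0 <= x -> x < 1 ->
  (1 - x) * (\sum_(i < n) x ^+ i) <= 1.
Proof.
move=> x0 x1; rewrite -[leLHS]opprK -mulNr opprB -subrX1 opprB.
by rewrite lerBlDr lerDl exprn_ge0.
Qed.

(** A term is a difference of two partial sums, both close to [l] eventually. *)
Lemma csums_terms_bounded c l :
  csums c l -> exists B, forall n, normc (c n) <= B.
Proof.
move=> /csums_normP cl.
have [N _ NP] := cl 1 ltr01.
exists (\sum_(i < N) normc (c i) + 2) => n.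
have S0 m : 0 <= \sum_(i < m) normc (c i).
  by apply: sumr_ge0 => i _; apply: normc_ge0.
have [nN|Nn] := ltnP n N.
  apply: ler_wpDr => //; apply: le_trans (_ : \sum_(i < n.+1) normc (c i) <= _).
    by rewrite big_ord_recr /= lerDr S0.
  apply: (@sum_ord_widen _ (fun i => normc (c i))) => // i.
  exact: normc_ge0.
apply: ler_wpDl => //.
have := NP _ Nn; have := NP n.+1 (leq_trans Nn (leqnSn n)) => /=.
rewrite big_ord_recr /=; set S := \sum_(i < n) c i => H1 H2.
rewrite (_ : c n = (S + c n - l) - (S - l)); last by ring.
by have := normcB_le (S + c n - l) (S - l); lra.
Qed.

Lemma pser_abs_bounded_lt1 c l (x : R) : csums c l -> 0 <= x -> x < 1 ->
  exists K, abs_bounded (fun n => c n * x%:C ^+ n) K.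
Proof.
move=> /csums_terms_bounded[B cB] x0 x1; exists (B / (1 - x)) => n.
have B0 : 0 <= B by apply: le_trans (cB 0%N); apply: normc_ge0.
rewrite ler_pdivlMr ?subr_gt0 // mulrC.
apply: le_trans (_ : (1 - x) * \sum_(i < n) B * x ^+ i <= _).
  rewrite ler_wpM2l ?subr_ge0 ?(ltW x1) //; apply: ler_sum => i _.
  rewrite Normc.normcM normcX normc_real ger0_norm //.
  by rewrite ler_wpM2r ?exprn_ge0.
by rewrite -mulr_sumr mulrCA -[leRHS]mulr1 ler_wpM2l // geometric_le.
Qed.

(** Abel's limit theorem; summation by parts replaces the terms by the distances
    of the partial sums to the limit. *)
Lemma abel_limit c l (f : R -> R[i]) : csums c l ->
  (forall x : R, 0 <= x -> x < 1 -> csums (fun n => c n * x%:C ^+ n) (f x)) ->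
  forall e : R, 0 < e ->
  exists2 d : R, 0 < d &
    forall x : R, 0 <= x -> x < 1 -> 1 - x < d -> normc (f x - l) < e.
Proof.
move=> /csums_normP cl cf e e0.
have e40 : 0 < e / 4 by rewrite divr_gt0.
pose P n := \sum_(i < n) c i - l.
have [N0 _ NP] := cl _ e40.
pose M := \sum_(i < N0) normc (P i.+1).
have M0 : 0 <= M by apply: sumr_ge0 => i _; apply: normc_ge0.
exists (e / 4 / (M + 1)); first by rewrite divr_gt0 // ltr_wpDl.
move=> x x0 x1; rewrite ltr_pdivlMr ?ltr_wpDl // => xd.
have X1 : (1 - x)%:C = 1 - x%:C :> R[i] by rewrite rmorphB rmorph1.
have parts N : \sum_(i < N) c i * x%:C ^+ i - l =
    (1 - x)%:C * (\sum_(i < N) P i.+1 * x%:C ^+ i) + x%:C ^+ N * P N.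
  elim: N => [|N IH].
    by rewrite !big_ord0 mulr0 !add0r expr0 mul1r /P big_ord0 add0r.
  rewrite big_ord_recr /= addrAC IH big_ord_recr /=.
  have -> : P N.+1 = P N + c N by rewrite /P big_ord_recr /=; ring.
  by rewrite exprS X1; ring.
have nx i : normc (x%:C ^+ i) = x ^+ i by rewrite normcX normc_real ger0_norm.
have major q : \sum_(i < N0 + q) normc (P i.+1 * x%:C ^+ i) <=
    M + \sum_(i < N0 + q) e / 4 * x ^+ i.
  rewrite 2!big_split_ord /= addrA; apply: lerD.
    apply: ler_wpDr.
      by apply: sumr_ge0 => i _; rewrite mulr_ge0 ?exprn_ge0 // ltW.
    apply: ler_sum => i _; rewrite Normc.normcM nx.
    by rewrite ler_piMr ?normc_ge0 // exprn_ile1 // ltW.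
  apply: ler_sum => i _; rewrite Normc.normcM nx ler_wpM2r ?exprn_ge0 //.
  by apply: ltW; apply: NP => /=; rewrite -addnS leq_addr.
have bound N : (N0 <= N)%N ->
    normc (\sum_(i < N) c i * x%:C ^+ i - l) < (1 - x) * M + e / 4 + e / 4.
  move=> N0N; rewrite parts; apply: le_lt_trans (normcD_le _ _) _.
  apply: ler_ltD; last first.
    rewrite Normc.normcM nx; apply: le_lt_trans (NP N N0N).
    by rewrite ler_piMl ?normc_ge0 // exprn_ile1 // ltW.
  rewrite Normc.normcM normc_real ger0_norm ?subr_ge0 ?(ltW x1) //.
  apply: le_trans (_ : (1 - x) * (M + \sum_(i < N) e / 4 * x ^+ i) <= _).
    rewrite ler_wpM2l ?subr_ge0 ?(ltW x1) //.
    apply: le_trans (normc_sum _ _ _) _.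
    by rewrite -(subnKC N0N); apply: major.
  rewrite mulrDr lerD2l -mulr_sumr mulrCA -[leRHS]mulr1.
  by rewrite ler_wpM2l ?geometric_le // ltW.
have [N1 _ N1P] := (csums_normP _ _).1 (cf x x0 x1) _ e40.
have := bound (maxn N0 N1) (leq_maxl _ _).
have := N1P (maxn N0 N1) (leq_maxr _ _) => /=.
set S := \sum_(i < _) _ => H1 H2.
rewrite (_ : f x - l = (S - l) - (S - f x)); last by ring.
have := normcB_le (S - l) (S - f x).
have : (1 - x) * M <= (1 - x) * (M + 1).
  by rewrite ler_wpM2l ?subr_ge0 ?(ltW x1) // lerDl ler01.
lra.
Qed.

End PowerSeries.

(** * Principal powers and the binomial series *)

Section PrincipalPowers.
Variable R : realType.
Implicit Types (z w a b : R[i]).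

Local Notation normc := (@Normc.normc R).
Local Notation Rec := (@complex.Re R).
Local Notation Imc := (@complex.Im R).
Local Notation pi := (@trigo.pi R).

Lemma cexpD z w : cexp (z + w) = cexp z * cexp w.
Proof.
case: z => x y; case: w => x' y'; rewrite /cexp /= expRD cosD sinD.
by apply/eqP; rewrite eq_complex /=; apply/andP; split; apply/eqP; ring.
Qed.

Lemma cexp0 : cexp 0 = 1 :> R[i].
Proof.
rewrite /cexp /= expR0 cos0 sin0.
by apply/eqP; rewrite eq_complex /= !mul1r !mul0r subr0 addr0 !eqxx.
Qed.

Lemma cexpN z : cexp (- z) = (cexp z)^-1.
Proof.
have /esym := cexpD z (- z); rewrite subrr cexp0 => e.
have z0 : cexp z != 0.
  by apply/eqP => z0; move: e; rewrite z0 mul0r => /esym/eqP; rewrite oner_eq0.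
by rewrite -[LHS](mulKf z0) e mulr1.
Qed.

Lemma normc_cexp z : normc (cexp z) = expR (Rec z).
Proof.
rewrite /cexp Normc.normcM normc_real gtr0_norm ?expR_gt0 //=.
by rewrite cos2Dsin2 sqrtr1 mulr1.
Qed.

Lemma cexp_neq0 z : cexp z != 0.
Proof. by rewrite -normc_gt0 normc_cexp expR_gt0. Qed.

Lemma cexpMn z n : cexp (n%:R * z) = cexp z ^+ n.
Proof.
elim: n => [|n IH]; first by rewrite mul0r cexp0 expr0.
by rewrite -natr1 mulrDl mul1r cexpD IH exprSr.
Qed.

Lemma Re_gt0_neq0 z : 0 < Rec z -> z != 0.
Proof. by apply: contraTneq => ->; rewrite ltxx. Qed.

Lemma Re_lt1 z : normc z < 1 -> 0 < Rec (1 - z).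
Proof.
move=> z1; rewrite raddfB /= subr_gt0; apply: le_lt_trans z1.
exact: le_trans (ler_norm _) (Re_le_normc _).
Qed.

Lemma normc_factor z : 0 < Rec z ->
  normc z = Rec z * Num.sqrt (1 + (Imc z / Rec z) ^+ 2).
Proof.
case: z => x y /= x0.
rewrite -[X in X * _](ger0_norm (ltW x0)) -sqrtr_sqr -sqrtrM ?sqr_ge0 //.
by rewrite mulrDr mulr1 expr_div_n [x ^+ 2 * _]mulrC divfK // sqrf_eq0 gt_eqF.
Qed.

Lemma cos_carg z : 0 < Rec z -> cos (atan (Imc z / Rec z)) = Rec z / normc z.
Proof.
move=> z0; rewrite cos_atan normc_factor // invfM mulrA divff ?mul1r //.
by rewrite gt_eqF.
Qed.

Lemma carg_atan z : 0 < Rec z -> carg z = atan (Imc z / Rec z).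
Proof.
move=> z0; rewrite /carg -cos_carg //.
set th := atan _.
have := atan_gtNpi2 (Imc z / Rec z); have := atan_ltpi2 (Imc z / Rec z).
rewrite -/th => th1 th2.
have p0 := pi_gt0 R.
case: ifPn => [y0|]; last rewrite -ltNge => y0.
  have t0 : 0 <= th.
    by rewrite /th -[leLHS]atan0; apply: le_atan; rewrite divr_ge0 // ltW.
  by rewrite cosK // in_itv /= t0 /=; lra.
have t0 : th <= 0.
  rewrite /th -[leRHS]atan0; apply: le_atan.
  by rewrite pmulr_lle0 ?invr_gt0 ?ltW.
by rewrite cosKN ?opprK // t0 andbT; lra.
Qed.

Lemma cexp_clog z : 0 < Rec z -> cexp (clog z) = z.
Proof.
move=> z0; have n0 : 0 < normc z by rewrite normc_gt0 Re_gt0_neq0.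
have tn := atanK (Imc z / Rec z).
rewrite /cexp /clog /= lnK ?posrE // carg_atan //.
have cE := cos_carg z0.
have c0 : cos (atan (Imc z / Rec z)) != 0.
  by rewrite cE gt_eqF // divr_gt0.
have sE : sin (atan (Imc z / Rec z)) = Imc z / normc z.
  move: tn; rewrite /tan => /(congr1 (fun q => q * cos (atan (Imc z / Rec z)))).
  rewrite divfK // cE => ->.
  by field; rewrite !gt_eqF.
rewrite cE sE; apply/eqP; rewrite eq_complex /= !mul0r subr0 addr0.
by rewrite !(mulrC (normc z)) !divfK ?(gt_eqF n0) // !eqxx.
Qed.

Lemma cos_eq1_small (x : R) : `|x| < pi + pi / 2 -> cos x = 1 -> x = 0.
Proof.
move=> xp; rewrite -cos_norm; move: xp; have := normr_ge0 x.
set y := `|x| => y0 yp cy.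
have [yle|ylt] := leP y pi.
  apply/eqP; rewrite -normr_eq0 -/y; apply/eqP.
  by rewrite -[y]cosK ?in_itv /= ?y0 // cy acos1.
have : 0 < cos (y - pi).
  by apply: cos_gt0_pihalf; apply/andP; split; have := pi_gt0 R; lra.
by rewrite cosB cospi sinpi cy; lra.
Qed.

(** Arguments of numbers in the right half plane are less than a right angle,
    so those of a product add up without a multiple of a full turn. *)
Lemma clogM z w : 0 < Rec z -> 0 < Rec w -> 0 < Rec (z * w) ->
  clog (z * w) = clog z + clog w.
Proof.
move=> z0 w0 zw0.
have nz : 0 < normc z by rewrite normc_gt0 Re_gt0_neq0.
have nw : 0 < normc w by rewrite normc_gt0 Re_gt0_neq0.
have e1 : cexp (clog (z * w) - (clog z + clog w)) = 1.
  by rewrite cexpD cexpN cexpD !cexp_clog // mulfV // mulf_neq0 ?Re_gt0_neq0.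
have l0 : Rec (clog (z * w) - (clog z + clog w)) = 0.
  by rewrite !raddfB !raddfD /= Normc.normcM lnM ?posrE //; ring.
have a0 : Imc (clog (z * w) - (clog z + clog w)) = 0.
  apply: cos_eq1_small.
    rewrite !raddfB !raddfD /= !carg_atan //.
    have := atan_gtNpi2 (Imc z / Rec z); have := atan_ltpi2 (Imc z / Rec z).
    have := atan_gtNpi2 (Imc w / Rec w); have := atan_ltpi2 (Imc w / Rec w).
    have := atan_gtNpi2 (Imc (z * w) / Rec (z * w)).
    have := atan_ltpi2 (Imc (z * w) / Rec (z * w)).
    by rewrite ltr_norml => *; apply/andP; split; lra.
  move/(congr1 Rec): e1; rewrite /cexp l0 expR0 /=.
  by rewrite mul1r mul0r subr0.
by apply/eqP; rewrite -subr_eq0 eq_complex l0 a0 /= !eqxx.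
Qed.

Lemma clog1 : clog 1 = 0 :> R[i].
Proof.
by rewrite /clog Normc.normc1 ln1 carg_atan /= ?ltr01 // mul0r atan0.
Qed.

Lemma cpowDr z a b : cpow z (a + b) = cpow z a * cpow z b.
Proof. by rewrite /cpow mulrDl cexpD. Qed.

Lemma cpowNr z a : cpow z (- a) = (cpow z a)^-1.
Proof. by rewrite /cpow mulNr cexpN. Qed.

Lemma cpow_natM z n a : cpow z (n%:R * a) = cpow z a ^+ n.
Proof. by rewrite /cpow -mulrA cexpMn. Qed.

Lemma cpow0 z : cpow z 0 = 1.
Proof. by rewrite /cpow mul0r cexp0. Qed.

Lemma cpow1 z : 0 < Rec z -> cpow z 1 = z.
Proof. by move=> z0; rewrite /cpow mul1r cexp_clog. Qed.

Lemma cpow_neq0 z a : cpow z a != 0.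
Proof. exact: cexp_neq0. Qed.

Lemma cpowMl z w a : 0 < Rec z -> 0 < Rec w -> 0 < Rec (z * w) ->
  cpow (z * w) a = cpow z a * cpow w a.
Proof. by move=> *; rewrite /cpow clogM // mulrDr cexpD. Qed.

Lemma normc_cpow_real z (x : R) :
  normc (cpow z x%:C) = expR (x * ln (normc z)).
Proof. by rewrite /cpow normc_cexp /= mul0r subr0. Qed.

End PrincipalPowers.

Section BinomialSeries.
Variable R : realType.
Implicit Types (z w a b u : R[i]).

Local Notation normc := (@Normc.normc R).
Local Notation Rec := (@complex.Re R).
Local Notation Imc := (@complex.Im R).

Definition binom_coef a n : R[i] := pochn a n / n`!%:R.

Lemma pochnS a n : pochn a n.+1 = pochn a n * (a + n%:R).
Proof. by rewrite /pochn big_ord_recr. Qed.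

Lemma pochn_add a m n : pochn a (m + n) = pochn a m * pochn (a + m%:R) n.
Proof.
rewrite /pochn big_split_ord /=; congr (_ * _).
by apply: eq_bigr => i _; rewrite natrD addrA.
Qed.

Lemma pochn1 a : pochn a 1 = a.
Proof. by rewrite /pochn big_ord_recl big_ord0 mulr1 addr0. Qed.

Lemma natSr_neq0 n : n.+1%:R != 0 :> R[i].
Proof. by rewrite pnatr_eq0. Qed.

Lemma binom_coef0 a : binom_coef a 0 = 1.
Proof. by rewrite /binom_coef /pochn big_ord0 fact0 divr1. Qed.

Lemma binom_coefS a n :
  binom_coef a n.+1 = binom_coef a n * ((a + n%:R) / n.+1%:R).
Proof.
rewrite /binom_coef pochnS factS natrM invfM.
by rewrite mulrACA [in LHS]mulrC [X in X * _]mulrC; ring.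
Qed.

Lemma binom_coefS_shift a n :
  n.+1%:R * binom_coef a n.+1 = a * binom_coef (a + 1) n.
Proof.
have f0 : n`!%:R != 0 :> R[i] by rewrite pnatr_eq0 -lt0n fact_gt0.
have := natSr_neq0 n; rewrite /binom_coef factS natrM.
rewrite -{3}(add1n n) pochn_add pochn1; move: n.+1%:R => N N0.
by field; rewrite N0 f0.
Qed.

Lemma binom_coef_pascal a n :
  binom_coef (a + 1) n.+1 - binom_coef (a + 1) n = binom_coef a n.+1.
Proof.
apply: (mulfI (natSr_neq0 n)); rewrite binom_coefS_shift binom_coefS.
have := natSr_neq0 n; rewrite -natr1; move: n%:R (binom_coef _ _) => m c m0.
by field.
Qed.

(** Bounding [a] by a natural number [B] turns the series into one whose partial
    sums are controlled by [(1 - x) ^- B], by Pascal's rule and induction on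
    [B]. *)
Lemma binom_abs_bounded a (B : nat) (x : R) :
  normc a <= B%:R -> 0 <= x -> x < 1 ->
  abs_bounded (fun n => binom_coef a n * x%:C ^+ n) ((1 - x) ^- B).
Proof.
move=> aB x0 x1.
pose p (C : nat) n : R := normc (binom_coef C%:R n).
have x1' : 0 < 1 - x by rewrite subr_gt0.
have pS C n : p C n.+1 = p C n * ((C + n)%:R / n.+1%:R).
  rewrite /p binom_coefS Normc.normcM (Normc.normcM (_ + _)) Normc.normcV.
  by rewrite -natrD !normc_nat.
have pascal C n : p C.+1 n.+1 = p C.+1 n + p C n.+1.
  have preal m D : p D m = \prod_(i < m) (D%:R + i%:R) / m`!%:R.
    rewrite /p /binom_coef Normc.normcM Normc.normcV normc_nat; congr (_ / _).
    rewrite normc_prod; apply: eq_bigr => i _; by rewrite -!natrD normc_nat.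
  have pC m D : (p D m)%:C = binom_coef D%:R m.
    rewrite preal rmorphM /= fmorphV rmorph_nat rmorph_prod; congr (_ / _).
    by apply: eq_bigr => i _; rewrite rmorphD !rmorph_nat.
  apply: (fmorph_inj (real_complex R)); rewrite /= rmorphD /= !pC.
  by rewrite -(binom_coef_pascal C%:R n) natr1; ring.
have pB C : abs_bounded (fun n => (p C n)%:C * x%:C ^+ n) ((1 - x) ^- C).
  have nE D n : normc ((p D n)%:C * x%:C ^+ n) = p D n * x ^+ n.
    rewrite Normc.normcM normcX !normc_real (ger0_norm x0) ger0_norm //.
    exact: normc_ge0.
  elim: C => [|C IH] n.
    rewrite expr0 invr1; case: n => [|n]; first by rewrite big_ord0.
    rewrite big_ord_recl big1 ?addr0; last first.
      move=> i _; rewrite nE /p /binom_coef /pochn big_ord_recl addr0 !mul0r.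
      by rewrite Normc.normc0 mul0r.
    by rewrite nE expr0 mulr1 /p binom_coef0 Normc.normc1.
  rewrite exprS invfM mulrC ler_pdivlMr // mulrC.
  apply: le_trans (IH n); under eq_bigr do rewrite nE.
  under [leRHS]eq_bigr do rewrite nE.
  case: n => [|n]; first by rewrite !big_ord0 mulr0.
  have -> : \sum_(i < n.+1) p C i * x ^+ i =
    (1 - x) * (\sum_(i < n.+1) p C.+1 i * x ^+ i) + p C.+1 n * x ^+ n.+1.
    elim: n => [|n IHn].
      rewrite !big_ord_recl !big_ord0 /= !addr0 /p !binom_coef0 Normc.normc1.
      by ring.
    rewrite big_ord_recr IHn [in RHS]big_ord_recr /= pascal.
    by rewrite [x ^+ n.+2]exprS; ring.
  rewrite lerDl mulr_ge0 ?exprn_ge0 //; exact: normc_ge0.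
apply: abs_bounded_le (pB B) => n.
rewrite (Normc.normcM (binom_coef a n)) (Normc.normcM (p B n)%:C).
rewrite ler_wpM2r ?normc_ge0 // normc_real ger0_norm ?normc_ge0 //.
elim: n => [|n IH]; first by rewrite /p !binom_coef0 Normc.normc1.
rewrite pS binom_coefS (Normc.normcM (binom_coef a n)).
apply: ler_pM; rewrite ?normc_ge0 //.
rewrite Normc.normcM Normc.normcV normc_nat ler_wpM2r ?invr_ge0 ?ler0n //.
by apply: le_trans (normcD_le _ _) _; rewrite normc_nat natrD lerD2r.
Qed.

(** Taken componentwise, so that the differentiation rules for real functions
    apply. *)
Definition is_cderive (x : R) (f : R -> R[i]) l :=
  is_derive x 1 (Rec \o f) (Rec l) /\ is_derive x 1 (Imc \o f) (Imc l).

Lemma is_cderiveM (x : R) (f g : R -> R[i]) l m :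
  is_cderive x f l -> is_cderive x g m ->
  is_cderive x (fun y => f y * g y) (l * g x + f x * m).
Proof.
move=> [fr fi] [gr gi]; split.
  have -> : Rec \o (fun y => f y * g y) =
      (Rec \o f) * (Rec \o g) - (Imc \o f) * (Imc \o g).
    by apply/funext => y /=; rewrite !fctE /=; case: (f y); case: (g y).
  apply: is_derive_eq; rewrite /= !/GRing.scale /=.
  by case: (f x) => ? ?; case: (g x) => ? ?; case: l {fr fi} => ? ?;
     case: m {gr gi} => ? ? /=; ring.
have -> : Imc \o (fun y => f y * g y) =
    (Rec \o f) * (Imc \o g) + (Imc \o f) * (Rec \o g).
  by apply/funext => y /=; rewrite !fctE /=; case: (f y); case: (g y).
apply: is_derive_eq; rewrite /= !/GRing.scale /=.
by case: (f x) => ? ?; case: (g x) => ? ?; case: l {fr fi} => ? ?;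
   case: m {gr gi} => ? ? /=; ring.
Qed.

Lemma is_cderiveZ (x : R) c (f : R -> R[i]) l :
  is_cderive x f l -> is_cderive x (fun y => c * f y) (c * l).
Proof.
move=> fl; have c' : is_cderive x (fun=> c) 0.
  by split; apply: is_derive_cst.
by have := is_cderiveM c' fl; rewrite mul0r add0r.
Qed.

Lemma is_cderive_cexp (x : R) (f : R -> R[i]) l :
  is_cderive x f l -> is_cderive x (fun y => cexp (f y)) (l * cexp (f x)).
Proof.
move=> [fr fi].
have er : is_derive x 1 (expR \o (Rec \o f)) (expR (Rec (f x)) * Rec l).
  exact: is_derive1_comp.
have co : is_derive x 1 (cos \o (Imc \o f)) (- sin (Imc (f x)) * Imc l).
  exact: is_derive1_comp.
have si : is_derive x 1 (sin \o (Imc \o f)) (cos (Imc (f x)) * Imc l).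
  exact: is_derive1_comp.
split.
  have -> : Rec \o (fun y => cexp (f y)) =
      (expR \o (Rec \o f)) * (cos \o (Imc \o f)).
    by apply/funext => y; rewrite /= fctE /= mul0r subr0.
  apply: is_derive_eq; rewrite /= /GRing.scale /=.
  case: l {fr fi er co si} => ? ? /=.
  by ring.
have -> : Imc \o (fun y => cexp (f y)) =
    (expR \o (Rec \o f)) * (sin \o (Imc \o f)).
  by apply/funext => y; rewrite /= fctE /= mul0r addr0.
apply: is_derive_eq; rewrite /= /GRing.scale /=.
case: l {fr fi er co si} => ? ? /=.
by ring.
Qed.

Lemma is_cderive_cst_segment (f : R -> R[i]) :
  (forall x : R, 0 <= x <= 1 -> is_cderive x f 0) -> f 1 = f 0.
Proof.
move=> f0.
have key (g : R -> R) :
    (forall x : R, 0 <= x <= 1 -> is_derive x 1 g 0) -> g 1 = g 0.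
  move=> g0; have [||c _] := @MVT_segment R g (fun=> 0) 0 1 ler01.
  - move=> x; rewrite in_itv /= => /andP[/ltW x0 /ltW x1].
    by apply: g0; rewrite x0.
  - by apply: derivable_within_continuous => x; rewrite in_itv /= => /g0 [].
  by rewrite mul0r => /eqP; rewrite subr_eq0 => /eqP.
have er : Rec (f 1) = Rec (f 0) by apply: (key (Rec \o f)) => x /f0[].
have ei : Imc (f 1) = Imc (f 0) by apply: (key (Imc \o f)) => x /f0[].
by apply/eqP; rewrite eq_complex er ei !eqxx.
Qed.

End BinomialSeries.

Section BinomialTheorem.
Variable R : realType.
Implicit Types (z w a b u : R[i]) (c : nat -> R[i]).

Local Notation normc := (@Normc.normc R).
Local Notation Rec := (@complex.Re R).
Local Notation Imc := (@complex.Im R).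

Lemma Re_mul_real z (x : R) : Rec (z * x%:C) = Rec z * x.
Proof. by case: z => p q /=; rewrite mulr0 subr0. Qed.

Lemma Im_mul_real z (x : R) : Imc (z * x%:C) = Imc z * x.
Proof. by case: z => p q /=; rewrite mulr0 add0r. Qed.

Definition pser_sum c (x : R) : R[i] :=
  limn (pseries (Rec \o c) x) +i* limn (pseries (Imc \o c) x).

Lemma pser_cvg_ReIm c (k K x : R) :
  abs_bounded (fun n => c n * k%:C ^+ n) K -> `|x| <= k ->
  cvgn (pseries (Rec \o c) x) /\ cvgn (pseries (Imc \o c) x).
Proof.
move=> cK xk.
have xk' : normc x%:C <= k by rewrite normc_real.
have xK := pser_abs_bounded cK xk'.
split; apply: bounded_series_cvg xK => n; rewrite -rmorphXn /=.
  by rewrite -Re_mul_real Re_le_normc.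
by rewrite -Im_mul_real Im_le_normc.
Qed.

Lemma pser_sumP c (k K x : R) :
  abs_bounded (fun n => c n * k%:C ^+ n) K -> `|x| <= k ->
  csums (fun n => c n * x%:C ^+ n) (pser_sum c x).
Proof.
move=> cK xk; have [cr ci] := pser_cvg_ReIm cK xk.
apply: cvgc_ReIm => /=.
  have -> // : Rec \o series (fun n => c n * x%:C ^+ n) = pseries (Rec \o c) x.
  apply/funext => n; rewrite /pseries /series /= raddf_sum.
  by apply: eq_bigr => i _; rewrite -rmorphXn /= Re_mul_real.
have -> // : Imc \o series (fun n => c n * x%:C ^+ n) = pseries (Imc \o c) x.
apply/funext => n; rewrite /pseries /series /= raddf_sum.
by apply: eq_bigr => i _; rewrite -rmorphXn /= Im_mul_real.
Qed.

Definition deriv_coef c n := n.+1%:R * c n.+1.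

Lemma pser_sum_cderive c (k K0 K1 K2 x : R) :
  abs_bounded (fun n => c n * k%:C ^+ n) K0 ->
  abs_bounded (fun n => deriv_coef c n * k%:C ^+ n) K1 ->
  abs_bounded (fun n => deriv_coef (deriv_coef c) n * k%:C ^+ n) K2 ->
  `|x| < k -> is_cderive x (pser_sum c) (pser_sum (deriv_coef c) x).
Proof.
move=> c0 c1 c2 xk.
have k0 : 0 <= k by apply: le_trans (ltW xk).
have kk : `|k| <= k by rewrite ger0_norm.
have [r0 i0] := pser_cvg_ReIm c0 kk.
have [r1 i1] := pser_cvg_ReIm c1 kk.
have [r2 i2] := pser_cvg_ReIm c2 kk.
have dr c' : Rec \o deriv_coef c' = pseries_diffs (Rec \o c').
  apply/funext => n; rewrite /deriv_coef /pseries_diffs /=.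
  by rewrite mulr_natl raddfMn mulr_natl.
have di c' : Imc \o deriv_coef c' = pseries_diffs (Imc \o c').
  apply/funext => n; rewrite /deriv_coef /pseries_diffs /=.
  by rewrite mulr_natl raddfMn mulr_natl.
rewrite !dr in r1 r2; rewrite !di in i1 i2.
split; rewrite /pser_sum /= ?dr ?di.
  by apply: (pseries_snd_diffs r0 r1 r2); rewrite (ger0_norm k0).
by apply: (pseries_snd_diffs i0 i1 i2); rewrite (ger0_norm k0).
Qed.

(** The principal logarithm along the segment from [1] to [1 - u], written
    through [atan] so that it is visibly smooth. *)
Definition segment_log u (x : R) : R[i] :=
  ln (Num.sqrt ((1 - x * Rec u) ^+ 2 + (x * Imc u) ^+ 2))
  +i* atan (- (x * Imc u) / (1 - x * Rec u)).

Lemma segment_logE u (x : R) : 0 < 1 - x * Rec u ->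
  segment_log u x = clog (1 - u * x%:C).
Proof.
move=> x0.
have rE : Rec (1 - u * x%:C) = 1 - x * Rec u.
  by rewrite raddfB /= Re_mul_real mulrC.
have iE : Imc (1 - u * x%:C) = - (x * Imc u).
  by rewrite raddfB /= Im_mul_real mulrC sub0r.
rewrite /segment_log /clog carg_atan rE //.
congr (ln _ +i* atan (_ / _)); last first.
  by rewrite iE.
case: (1 - u * x%:C) rE iE => p q /= -> ->.
by rewrite sqrrN.
Qed.

Lemma segment_log_cderive u (x : R) : 0 < 1 - x * Rec u ->
  is_cderive x (segment_log u) (- u / (1 - u * x%:C)).
Proof.
move=> x0.
pose A y : R := 1 - y * Rec u; pose B y : R := - (y * Imc u).
have dA : is_derive x 1 A (- Rec u).
  have -> : A = cst 1 - (Rec u \*: id).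
    by apply/funext => y; rewrite /A !fctE /= /GRing.scale /= mulrC.
  apply: is_derive_eq; by rewrite sub0r /GRing.scale /= mulr1.
have dB : is_derive x 1 B (- Imc u).
  have -> : B = - (Imc u \*: id).
    by apply/funext => y; rewrite /B !fctE /= /GRing.scale /= mulrC.
  apply: is_derive_eq; by rewrite /GRing.scale /= mulr1.
have S0 : 0 < A x ^+ 2 + B x ^+ 2 by rewrite ltr_wpDr ?sqr_ge0 // exprn_gt0.
have dS : is_derive x 1 (A * A + B * B) (2 * (A x * - Rec u + B x * - Imc u)).
  by apply: is_derive_eq; rewrite /GRing.scale /=; ring.
have Sx : (A * A + B * B) x = A x ^+ 2 + B x ^+ 2 by rewrite !fctE !expr2.
have lE : - u / (1 - u * x%:C) =
   ((A x * - Rec u + B x * - Imc u) / (A x ^+ 2 + B x ^+ 2)) +i*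
   ((- Imc u * A x - - Rec u * B x) / (A x ^+ 2 + B x ^+ 2)).
  have zE : 1 - u * x%:C = A x +i* B x.
    rewrite /A /B; case: u {x0 A B dA dB S0 dS Sx} => p q.
    by apply/eqP; rewrite eq_complex /=; apply/andP; split; apply/eqP; ring.
  have z0 : 1 - u * x%:C != 0.
    by rewrite zE eq_complex /= negb_and (gt_eqF (x0 : 0 < A x)).
  apply: (canLR (mulfK z0)); rewrite zE.
  move: S0; move: (A x) (B x) => p q S0.
  case: u {x0 A B dA dB dS Sx zE z0} => v w.
  have S0' : p ^+ 2 + q ^+ 2 != 0 by rewrite gt_eqF.
  by apply/eqP; rewrite eq_complex /=; apply/andP; split; apply/eqP; field.
rewrite lE; split.
  have -> : Rec \o segment_log u = @ln R \o (Num.sqrt \o (A * A + B * B)).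
    by apply/funext => y; rewrite /= /A /B !fctE /= mulrNN !expr2.
  have ds : is_derive x 1 (Num.sqrt \o (A * A + B * B))
     ((2 * Num.sqrt (A x ^+ 2 + B x ^+ 2))^-1 *
      (2 * (A x * - Rec u + B x * - Imc u))).
    by apply: is_derive1_comp; rewrite Sx; apply: is_derive1_sqrt.
  have q0 : 0 < Num.sqrt (A x ^+ 2 + B x ^+ 2) by rewrite sqrtr_gt0.
  have dl : is_derive ((Num.sqrt \o (A * A + B * B)) x) 1 (@ln R)
     (Num.sqrt (A x ^+ 2 + B x ^+ 2))^-1.
    by rewrite /= Sx; apply: is_derive1_ln.
  have H := is_derive1_comp dl ds.
  apply: is_derive_eq => /=.
  rewrite -[X in _ = _ / X](sqr_sqrtr (ltW S0)).
  move: q0; move: (Num.sqrt _) => q q0.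
  by field; rewrite gt_eqF.
have Ax0 : A x != 0 by rewrite gt_eqF.
have -> : Imc \o segment_log u = @atan R \o (B * (fun y => (A y)^-1)).
  by apply/funext => y; rewrite /= /A /B !fctE.
have dV : is_derive x 1 (fun y => (A y)^-1) (- (A x) ^- 2 *: (- Rec u)).
  exact: is_deriveV.
have dq : is_derive x 1 (B * (fun y => (A y)^-1))
    (B x * ((A x) ^- 2 * Rec u) + (A x)^-1 * (- Imc u)).
  by apply: is_derive_eq; rewrite /GRing.scale /=; ring.
have H := is_derive1_comp (is_derive1_atan ((B * (fun y => (A y)^-1)) x)) dq.
apply: is_derive_eq => /=.
rewrite !fctE /=.
move: S0 Ax0; move: (A x) (B x) => p q S0 p0.
have S0' : p ^+ 2 + q ^+ 2 != 0 by rewrite gt_eqF.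
by field; rewrite p0 S0'.
Qed.

(** Both [(1 - x u) ^ (-a)] and the binomial series solve
    [(1 - x u) y' = a u y] on [0 <= x <= 1], so that their quotient is constant
    along the segment. *)
Lemma binomial_series a u : normc u < 1 ->
  csums (fun n => binom_coef a n * u ^+ n) (cpow (1 - u) (- a)).
Proof.
move=> u1.
have u0 := normc_ge0 u.
(* a radius beyond 1 makes the end point [x = 1] of the segment interior *)
pose k : R := 2 / (1 + normc u).
have k1 : 1 < k by rewrite /k ltr_pdivlMr; lra.
have k0 : 0 <= k by lra.
have uk1 : normc u * k < 1 by rewrite /k mulrA ltr_pdivrMr; lra.
pose c b n := binom_coef b n * u ^+ n.
have cK b : exists K, abs_bounded (fun n => c b n * k%:C ^+ n) K.
  have v0 : 0 <= normc u * k by rewrite mulr_ge0.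
  have bB : normc b <= (Num.truncn (normc b)).+1%:R.
    by rewrite ltW // truncnS_gt.
  have H := binom_abs_bounded bB v0 uk1.
  exists ((1 - normc u * k) ^- (Num.truncn (normc b)).+1).
  apply: abs_bounded_le H => n.
  rewrite /c -mulrA !(Normc.normcM (binom_coef b n)).
  rewrite -exprMn !normcX normc_real (Normc.normcM u) normc_real (ger0_norm k0).
  by rewrite (ger0_norm v0).
have dc b : deriv_coef (c b) = (fun n => (b * u) * c (b + 1) n).
  apply/funext => n; rewrite /deriv_coef /c mulrA binom_coefS_shift exprS.
  by ring.
have [K0 cK0] := cK a; have [K1 cK1] := cK (a + 1).
have [K2 cK2] := cK (a + 1 + 1).
have d1 : abs_bounded (fun n => deriv_coef (c a) n * k%:C ^+ n)
    (normc (a * u) * K1).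
  by rewrite dc; apply: abs_bounded_le (abs_boundedZ _ cK1) => n; rewrite mulrA.
have d2 : abs_bounded (fun n => deriv_coef (deriv_coef (c a)) n * k%:C ^+ n)
    (normc (a * u * ((a + 1) * u)) * K2).
  apply: abs_bounded_le (abs_boundedZ _ cK2) => n.
  have -> : deriv_coef (deriv_coef (c a)) n = a * u * deriv_coef (c (a + 1)) n.
    by rewrite dc /deriv_coef; ring.
  by rewrite dc !mulrA.
pose y x := pser_sum (c a) x * cexp (a * segment_log u x).
have pos (x : R) : 0 <= x <= 1 -> 0 < 1 - x * Rec u.
  move=> /andP[x0 x1]; rewrite subr_gt0; apply: le_lt_trans u1.
  apply: le_trans (ler_norm _) _; rewrite normrM (ger0_norm x0).
  by rewrite -[leRHS]mul1r ler_pM // Re_le_normc.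
have ode (x : R) : 0 <= x <= 1 -> (1 - u * x%:C) * pser_sum (c (a + 1)) x
    = pser_sum (c a) x.
  move=> /andP[x0 x1].
  have xk : `|x| <= k by rewrite ger0_norm //; lra.
  have s1 := pser_sumP cK1 xk; have s0 := pser_sumP cK0 xk.
  have xs := csumsZ (u * x%:C) s1.
  rewrite mulrBl mul1r; apply: csums_unique s0.
  (* the term of index n of u x times the series is that of index n + 1 *)
  pose v n := if n is m.+1 then u * x%:C * (c (a + 1) m * x%:C ^+ m) else 0.
  have vs : csums v (u * x%:C * pser_sum (c (a + 1)) x).
    have := @csums_shift R v (u * x%:C * pser_sum (c (a + 1)) x) 1.
    rewrite big_ord_recl big_ord0 /= !add0r; apply.
    by apply: csums_ext xs => n; rewrite addn1.
  apply: csums_ext (csumsB s1 vs) => -[|n] /=.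
    by rewrite /c !binom_coef0 subr0.
  by rewrite /c -(binom_coef_pascal a n) !exprS; ring.
have dy (x : R) : 0 <= x <= 1 -> is_cderive x y 0.
  move=> x01; have /andP[x0 x1] := x01.
  have xk : `|x| < k by rewrite ger0_norm //; lra.
  have D1 := pser_sum_cderive cK0 d1 d2 xk.
  have D2 := is_cderive_cexp (is_cderiveZ a (segment_log_cderive (pos x x01))).
  have := is_cderiveM D1 D2; congr (is_cderive _ _ _).
  have -> : pser_sum (deriv_coef (c a)) x = a * u * pser_sum (c (a + 1)) x.
    apply: csums_unique (pser_sumP d1 (ltW xk)) _.
    apply: csums_ext (csumsZ (a * u) (pser_sumP cK1 (ltW xk))) => n.
    by rewrite dc mulrA.
  rewrite -(ode x x01).
  have z0 : 1 - u * x%:C != 0.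
    apply: Re_gt0_neq0; rewrite raddfB /= Re_mul_real mulrC; exact: pos.
  by field.
have := is_cderive_cst_segment dy.
have i01 : 0 <= (0 : R) <= 1 by rewrite lexx ler01.
have i11 : 0 <= (1 : R) <= 1 by rewrite lexx ler01.
rewrite /y !segment_logE ?pos // mulr1 mulr0 subr0.
have -> : pser_sum (c a) 0 = 1.
  have z : `|0 : R| <= k by rewrite normr0.
  apply: csums_unique (pser_sumP cK0 z) _.
  have := @csums_finite R (fun n => c a n * (0 : R)%:C ^+ n) 1 _.
  rewrite big_ord_recl big_ord0 /= addr0 expr0 mulr1 /c binom_coef0 expr0 mulr1.
  by apply => -[//|n] _; rewrite expr0n /= mulr0.
have -> : cexp (a * clog 1) = 1.
  by rewrite clog1 mulr0 cexp0.
rewrite mulr1 => e1.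
have -> : cpow (1 - u) (- a) = pser_sum (c a) 1.
  by rewrite (canRL (mulfK (cexp_neq0 _)) e1) mul1r cpowNr.
have one : `|1 : R| <= k by rewrite normr1 ltW.
apply: csums_ext (pser_sumP cK0 one) => n.
by rewrite /c expr1n mulr1.
Qed.

End BinomialTheorem.

(** * Pochhammer symbols with a real index *)

Section Pochhammer.
Variable R : realType.
Implicit Types (z w a b : R[i]).

Local Notation normc := (@Normc.normc R).

Lemma not_nonpos_int_neq0 z n : ~ nonpos_int z -> z + n%:R != 0.
Proof.
move=> zn; apply/eqP => z0; apply: zn; exists n.
by rewrite -[z](addrK n%:R) z0 add0r.
Qed.

Lemma not_nonpos_int_add z n : ~ nonpos_int z -> ~ nonpos_int (z + n%:R).
Proof.
move=> zn [m zm]; apply: zn; exists (m + n)%N.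
by rewrite natrD opprD -zm addrK.
Qed.

Lemma pochn_neq0 z n : ~ nonpos_int z -> pochn z n != 0.
Proof.
by move=> zn; apply/prodf_neq0 => i _; apply: not_nonpos_int_neq0.
Qed.

Definition gauss_seq z (n : nat) : R[i] :=
  n`!%:R * cpow n%:R z / pochn z n.+1.

Lemma gauss_seq_shift z n : ~ nonpos_int z -> (0 < n)%N ->
  gauss_seq (z + 1) n * ((z + 1 + n%:R) / n%:R) = z * gauss_seq z n.
Proof.
move=> zn n0; rewrite /gauss_seq.
have nz : n%:R != 0 :> R[i] by rewrite pnatr_eq0 -lt0n.
have re : 0 < complex.Re (n%:R : R[i]).
  by rewrite -(rmorph_nat (real_complex R)) /= ltr0n.
rewrite cpowDr cpow1 //.
have e : pochn z n.+1 * (z + 1 + n%:R) = z * pochn (z + 1) n.+1.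
  have := pochn_add z 1 n.+1; rewrite pochn1 => <-.
  by rewrite add1n (pochnS z n.+1) -natr1; congr (_ * _); ring.
have p0 := pochn_neq0 n.+1 zn.
have p1 : pochn (z + 1) n.+1 != 0.
  by apply: pochn_neq0; apply: (@not_nonpos_int_add z 1).
apply: (mulIf p1); apply: (mulIf p0).
transitivity (n`!%:R * cpow n%:R z * (pochn z n.+1 * (z + 1 + n%:R))).
  by field; rewrite nz p1.
by rewrite e; field; rewrite p0.
Qed.

(** The recurrence survives wherever Gauss's limit fails to exist: the sequences
    at [z] and at [z + 1] are then both divergent, and both limits take the
    default value 0. *)
Lemma GammaS z : ~ nonpos_int z -> Gamma (z + 1) = z * Gamma z.
Proof.
move=> zn.
have z0 : z != 0 by rewrite -[z]addr0; apply: (@not_nonpos_int_neq0 z 0).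
pose q n : R[i] := (z + 1 + n%:R) / n%:R.
have q1 : (q : nat -> R[i]^o) @ \oo --> (1 : R[i]^o).
  apply/cvgc_normP => e e0; near=> n.
  have n0 : (0 < n)%N by near: n; exists 1%N.
  have nz : n%:R != 0 :> R[i] by rewrite pnatr_eq0 -lt0n.
  have -> : q n - 1 = (z + 1) / n%:R by rewrite /q; field.
  rewrite Normc.normcM Normc.normcV normc_nat ltr_pdivrMr ?ltr0n //.
  rewrite mulrC -ltr_pdivrMr //.
  apply: lt_le_trans (truncnS_gt _) _; rewrite ler_nat.
  by near: n; exists (Num.truncn (normc (z + 1) / e)).+1.
have q1V : ((fun n => (q n)^-1) : nat -> R[i]^o) @ \oo --> (1 : R[i]^o).
  by rewrite -[X in _ --> X]invr1; apply: (@cvgV R[i]) (oner_neq0 _) q1.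
have up (L : R[i]) : (gauss_seq z : nat -> R[i]^o) @ \oo --> (L : R[i]^o) ->
    (gauss_seq (z + 1) : nat -> R[i]^o) @ \oo --> (z * L : R[i]^o).
  move=> zL; rewrite -[z * L]mulr1.
  have H := cvgcM (cvgcM (cvgc_cst z) zL) q1V.
  apply: (cvgc_near_eq _ H); near=> n.
  have n0 : (0 < n)%N by near: n; exists 1%N.
  have qn : q n != 0.
    rewrite /q mulf_neq0 ?invr_eq0 ?pnatr_eq0 -?lt0n //.
    by rewrite -addrA nat1r; apply: not_nonpos_int_neq0.
  rewrite -[RHS](mulfK qn); congr (_ / _).
  by rewrite gauss_seq_shift.
have down (L : R[i]) :
    (gauss_seq (z + 1) : nat -> R[i]^o) @ \oo --> (L : R[i]^o) ->
    (gauss_seq z : nat -> R[i]^o) @ \oo --> (z^-1 * (L * 1) : R[i]^o).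
  move=> zL.
  have H := cvgcM (cvgc_cst z^-1) (cvgcM zL q1).
  apply: (cvgc_near_eq _ H); near=> n.
  have n0 : (0 < n)%N by near: n; exists 1%N.
  by rewrite -[RHS](mulKf z0) -gauss_seq_shift.
have [[L zL]|nz] := pselect (exists L : R[i],
    (gauss_seq z : nat -> R[i]^o) @ \oo --> (L : R[i]^o)).
  by rewrite /Gamma (cvgc_lim (up L zL)) (cvgc_lim zL).
have dv (w : R[i]) : ~ (exists L : R[i],
    (gauss_seq w : nat -> R[i]^o) @ \oo --> (L : R[i]^o)) -> Gamma w = 0.
  move=> nw; apply: (@dvgP R[i]^o) => cw; apply: nw.
  by exists (limn (gauss_seq w : nat -> R[i]^o)).
rewrite !dv ?mulr0 // => -[L /down zL]; apply: nz.
by exists (z^-1 * (L * 1)).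
Unshelve. all: by end_near. Qed.

Lemma Gamma_addn z n : ~ nonpos_int z -> Gamma (z + n%:R) = pochn z n * Gamma z.
Proof.
move=> zn; elim: n => [|n IH].
  by rewrite addr0 /pochn big_ord0 mul1r.
rewrite -natr1 addrA GammaS; last exact: not_nonpos_int_add.
by rewrite IH pochnS; ring.
Qed.

Lemma poch_natr a n : poch a (n%:R : R) = pochn a n.
Proof. by rewrite /poch natr_nat natrK. Qed.

(** Both sides are [(a)_(m + nu)]. *)
Lemma pochn_mul_poch a m (nu : R) : poch_defined a nu ->
  pochn a m * poch (a + m%:R) nu = poch a nu * pochn (a + nu%:C) m.
Proof.
rewrite /poch_defined; case: (boolP (nu \is a Num.nat)) => [|nnu].
  move=> /natrP[n ->] _.
  by rewrite !poch_natr rmorph_nat -!pochn_add addnC.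
case=> [//|[an anu]]; rewrite /poch (negPf nnu).
have -> : a + m%:R + nu%:C = a + nu%:C + m%:R by ring.
rewrite !Gamma_addn // invfM.
have := pochn_neq0 m an; move: (pochn a m) (Gamma _)^-1 => x y x0.
by field.
Qed.

End Pochhammer.

(** * The multiple series and its local expansion *)

Section CubeSums.
Variables (R : realType) (r : nat).
Implicit Types (V : nmodType) (n : nat).

Local Notation normc := (@Normc.normc R).

Definition cube_sum V (T : ('I_r -> nat) -> V) n : V :=
  \sum_(m : {ffun 'I_r -> 'I_n}) T (fun i => m i : nat).

(** The multi-indices whose largest entry is exactly [n]; summing over shells
    turns a multiple series into a simple one. *)
Definition shell_sum V (T : ('I_r -> nat) -> V) n : V :=
  \sum_(m : {ffun 'I_r -> 'I_n.+1} | ~~ [forall i, (m i < n)%N])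
    T (fun i => m i : nat).

Lemma cube_sumS V (T : ('I_r -> nat) -> V) n :
  cube_sum T n.+1 = cube_sum T n + shell_sum T n.
Proof.
rewrite /cube_sum (bigID (fun m : {ffun 'I_r -> 'I_n.+1} =>
  [forall i, (m i < n)%N])) /=; congr (_ + _).
pose h (m : {ffun 'I_r -> 'I_n}) : {ffun 'I_r -> 'I_n.+1} :=
  [ffun i => widen_ord (leqnSn n) (m i)].
have hinj : injective h.
  move=> m m' /ffunP mm; apply/ffunP => i; apply: val_inj.
  by have := mm i; rewrite !ffunE => /(congr1 val).
rewrite (reindex_omap h (fun m => [pick j | h j == m])) /=; last first.
  move=> m /forallP mn.
  case: pickP => [j /eqP <- //|none].
  have := none [ffun i => Ordinal (mn i)]; rewrite -[_ == _]negbK => /negbT.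
  by rewrite negbK => /eqP[]; apply/ffunP => i; rewrite !ffunE; apply: val_inj.
apply: eq_big => [m|m _]; last first.
  by congr T; apply/funext => i; rewrite ffunE.
apply/andP; split.
  by apply/forallP => i; rewrite ffunE /= ltn_ord.
case: pickP => [j /eqP/hinj -> //|/(_ m)]; by rewrite eqxx.
Qed.

Lemma series_shell_sum (V : zmodType) (T : ('I_r -> nat) -> V) : (0 < r)%N ->
  series (shell_sum T) = cube_sum T.
Proof.
move=> r0; apply/funext; elim=> [|n IH].
  rewrite /series /= big_geq // /cube_sum big1 // => m _.
  by case: (m (Ordinal r0)).
by rewrite cube_sumS -IH /series /= big_nat_recr.
Qed.

Lemma cube_sum_ord (T : ('I_r -> nat) -> R) n : (0 < r)%N ->
  cube_sum T n = \sum_(i < n) shell_sum T i.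
Proof. by move=> r0; rewrite -series_shell_sum // /series /= big_mkord. Qed.

Lemma shell_sum_ge0 (T : ('I_r -> nat) -> R) n :
  (forall m, 0 <= T m) -> 0 <= shell_sum T n.
Proof. by move=> T0; apply: sumr_ge0. Qed.

Lemma normc_shell_sum (T : ('I_r -> nat) -> R[i]) n :
  normc (shell_sum T n) <= shell_sum (normc \o T) n.
Proof. exact: normc_sum. Qed.

Lemma le_shell_sum (T U : ('I_r -> nat) -> R) n :
  (forall m, T m <= U m) -> shell_sum T n <= shell_sum U n.
Proof. by move=> TU; apply: ler_sum. Qed.

Lemma le_cube_sum (T U : ('I_r -> nat) -> R) n :
  (forall m, T m <= U m) -> cube_sum T n <= cube_sum U n.
Proof. by move=> TU; apply: ler_sum. Qed.

Lemma cube_sum_bounded (T : ('I_r -> nat) -> R) : (forall m, 0 <= T m) ->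
  cvgn (cube_sum T) -> exists K, forall n, cube_sum T n <= K.
Proof.
move=> T0 cT; exists (limn (cube_sum T)) => n.
apply: nondecreasing_cvgn_le => //; apply/nondecreasing_seqP => m.
by rewrite cube_sumS lerDl shell_sum_ge0.
Qed.

Lemma shell_sum_abs_bounded (T : ('I_r -> nat) -> R[i]) (K : R) : (0 < r)%N ->
  (forall n, cube_sum (normc \o T) n <= K) -> abs_bounded (shell_sum T) K.
Proof.
move=> r0 TK n; apply: le_trans (TK n); rewrite cube_sum_ord //.
by apply: ler_sum => i _; apply: normc_shell_sum.
Qed.

Lemma shell_sumZ (c : R[i]) (T : ('I_r -> nat) -> R[i]) n :
  shell_sum (fun m => c * T m) n = c * shell_sum T n.
Proof. by rewrite /shell_sum mulr_sumr. Qed.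

Lemma eq_shell_sum (T U : ('I_r -> nat) -> R[i]) n :
  T =1 U -> shell_sum T n = shell_sum U n.
Proof. by move=> /funext ->. Qed.

(** Expanding each [(1 - u) ^ (- a M)] by the binomial series and exchanging the
    two summations. The size of [a M] grows at most linearly with the
    multi-index [M], so that the binomial series of absolute values costs one
    factor [(1 - v) ^- P <= d] per unit of [M]; the geometric factor [d] by
    which the hypothesis exceeds plain convergence pays for it. *)
Lemma multi_binomial_exchange (g a : ('I_r -> nat) -> R[i]) (B P : nat)
    (d v K : R) :
  (0 < r)%N -> 0 < v -> v < 1 -> (1 - v) ^- P <= d ->
  (forall M, normc (a M) <= (B + P * \sum_i M i)%N%:R) ->
  (forall n, cube_sum (fun M => normc (g M) * d ^+ (\sum_i M i)%N) n <= K) ->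
  exists c (L : R), [/\ abs_bounded (fun m => c m * v%:C ^+ m) L,
    forall m, csums (shell_sum (fun M => g M * binom_coef (a M) m)) (c m) &
    forall u, normc u <= v -> exists l, csums (fun m => c m * u ^+ m) l /\
      csums (shell_sum (fun M => g M * cpow (1 - u) (- a M))) l].
Proof.
move=> r0 v0 v1 vd aM gK.
have v1' : 0 < 1 - v by rewrite subr_gt0.
have d0 : 0 <= d by apply: le_trans vd; rewrite invr_ge0 exprn_ge0 // ltW.
pose f (u : R[i]) (n m : nat) : R[i] :=
  shell_sum (fun M => g M * (binom_coef (a M) m * u ^+ m)) n.
pose L := (1 - v) ^- B * K.
have fK u : normc u <= v -> forall N Q,
    \sum_(n < N) \sum_(m < Q) normc (f u n m) <= L.
  move=> uv N Q.
  apply: le_trans (_ : \sum_(n < N) shell_sum (fun M => normc (g M) *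
      \sum_(m < Q) normc (binom_coef (a M) m * u ^+ m)) n <= _).
    apply: ler_sum => n _.
    apply: le_trans (_ : \sum_(m < Q) shell_sum (fun M =>
      normc (g M) * normc (binom_coef (a M) m * u ^+ m)) n <= _).
      apply: ler_sum => m _; apply: le_trans (normc_shell_sum _ _) _.
      by apply: le_shell_sum => M /=; rewrite Normc.normcM.
    rewrite /shell_sum exchange_big /=; apply: ler_sum => M _.
    by rewrite mulr_sumr.
  rewrite -cube_sum_ord //; apply: le_trans (_ : cube_sum (fun M =>
    (1 - v) ^- B * (normc (g M) * d ^+ (\sum_i M i)%N)) N <= _).
    apply: le_cube_sum => M; rewrite mulrCA ler_wpM2l ?normc_ge0 //.
    have H := binom_abs_bounded (aM M) (ltW v0) v1.
    apply: le_trans (pser_abs_bounded H uv Q) _.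
    rewrite exprD invfM ler_wpM2l ?invr_ge0 ?exprn_ge0 ?(ltW v1') //.
    rewrite exprM -exprVn lerXn2r ?nnegrE ?invr_ge0 ?exprn_ge0 ?(ltW v1') //.
  rewrite /cube_sum -mulr_sumr; apply: ler_wpM2l (gK N).
  by rewrite invr_ge0 exprn_ge0 // ltW.
have nv : normc v%:C <= v by rewrite normc_real gtr0_norm.
have fE (u : R[i]) (n m : nat) :
    f u n m = u ^+ m * shell_sum (fun M => g M * binom_coef (a M) m) n.
  by rewrite -shell_sumZ; apply: eq_shell_sum => M; ring.
have cex m : exists s : R[i],
    csums (shell_sum (fun M => g M * binom_coef (a M) m)) s.
  have [l fl] : exists l, csums (fun n => f v%:C n m) l.
    apply: (@abs_bounded_csums _ _ L) => N.
    apply: le_trans (fK _ nv N m.+1); apply: ler_sum => n _.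
    rewrite big_ord_recr /= lerDr sumr_ge0 // => j _; exact: normc_ge0.
  exists ((v%:C ^+ m)^-1 * l); apply: csums_ext (csumsZ _ fl) => n.
  by rewrite fE mulKf // expf_neq0 // fmorph_eq0 gt_eqF.
have [c cP] := boolp.choice cex.
have col (u : R[i]) (m : nat) : csums (fun n => f u n m) (c m * u ^+ m).
  by rewrite mulrC; apply: csums_ext (csumsZ (u ^+ m) (cP m)) => n; rewrite fE.
have row (u : R[i]) (n : nat) : normc u <= v ->
    csums (f u n) (shell_sum (fun M => g M * cpow (1 - u) (- a M)) n).
  move=> uv; apply: csums_sum => M _; apply: csumsZ; apply: binomial_series.
  exact: le_lt_trans v1.
exists c, L; split => //.
  apply: row_sums_abs_bounded (fun m => col v%:C m) => N Q.
  by rewrite exchange_big /=; apply: fK.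
move=> u uv; have [l [gl hl]] := csums_exchange (fK u uv)
  (fun n => row u n uv) (col u).
by exists l.
Qed.

End CubeSums.

Section LocalExpansion.
Variables (R : realType) (r k : nat) (rho : R).
Variables (beta gamma : 'I_r -> R[i]).
Hypothesis (r_gt0 : (0 < r)%N) (rho_ge0 : 0 <= rho).
Implicit Types (t u lambda : R[i]) (w x : 'I_r -> R[i]) (M : 'I_r -> nat).

Local Notation normc := (@Normc.normc R).
Local Notation term := (fun lambda w => E_term k rho lambda beta gamma w).
Local Notation idx := (E_index k rho).

Lemma E_cube_sum lambda w L :
  csums (shell_sum (term lambda w)) L -> E k rho lambda beta gamma w = L.
Proof. by rewrite /csums series_shell_sum // => /cvgc_lim. Qed.

Lemma E_abs_cvg_bounded lambda w : E_abs_cvg k rho lambda beta gamma w ->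
  exists K, forall n, cube_sum (normc \o term lambda w) n <= K.
Proof. by apply: cube_sum_bounded => M; apply: normc_ge0. Qed.

Lemma normc_E_term_le lambda w x (d : R) M : 0 <= d ->
  (forall i, normc (w i) <= d * normc (x i)) ->
  normc (term lambda w M) <= d ^+ (\sum_i M i)%N * normc (term lambda x M).
Proof.
move=> d0 wx; rewrite /E_term 2!(Normc.normcM (poch _ _ * _)) [leRHS]mulrCA.
rewrite ler_wpM2l ?normc_ge0 // !normc_prod expr_sum -big_split /=.
apply: ler_prod => i _; rewrite normc_ge0 /= !Normc.normcM mulrA !normcX.
rewrite ler_wpM2r ?normc_ge0 // -exprMn lerXn2r ?nnegrE ?mulr_ge0 ?normc_ge0 //.
Qed.

Lemma E_abs_cvg_le lambda w x : (forall i, normc (w i) <= normc (x i)) ->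
  E_abs_cvg k rho lambda beta gamma x ->
  exists K, forall n, cube_sum (normc \o term lambda w) n <= K.
Proof.
move=> wx /E_abs_cvg_bounded[K xK]; exists K => n.
apply: le_trans (xK n); apply: le_cube_sum => M /=.
rewrite -[leRHS]mul1r -[X in X * _](expr1n _ (\sum_i M i)).
by apply: normc_E_term_le => // i; rewrite mul1r.
Qed.

Lemma E_csums lambda w (K : R) :
  (forall n, cube_sum (normc \o term lambda w) n <= K) ->
  csums (shell_sum (term lambda w)) (E k rho lambda beta gamma w).
Proof.
move=> wK; have [l wl] := abs_bounded_csums (shell_sum_abs_bounded r_gt0 wK).
by rewrite (E_cube_sum wl).
Qed.

Lemma E_term_shift lambda w m M : poch_defined lambda (idx M) ->
  pochn lambda m / m`!%:R * term (lambda + m%:R) w M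
  = term lambda w M * binom_coef (lambda + (idx M)%:C) m.
Proof.
move=> /(pochn_mul_poch m) e; rewrite /E_term /binom_coef.
transitivity (pochn lambda m * poch (lambda + m%:R) (idx M) / m`!%:R *
  ((\prod_(i < r | (k <= i)%N) pochn (beta i) (M i))
     / \prod_(i < r) pochn (gamma i) (M i)) *
  \prod_(i < r) (w i ^+ M i / (M i)`!%:R)); first by ring.
by rewrite e; ring.
Qed.

(** The weights [rho] and 1 of the variables in the index are the exponents of
    [1 - t] in their rescaling. *)
Lemma E_term_rescale lambda w t M : normc t < 1 ->
  term lambda (rescale k rho t w) M
  = term lambda w M * cpow (1 - t) (- (idx M)%:C).
Proof.
move=> t1; rewrite /E_term -[RHS]mulrA; congr (_ * _).
have re := Re_lt1 t1.
pose pw (i : 'I_r) : R[i] := if (i < k)%N then rho%:C else 1.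
have -> : - (idx M)%:C = - \sum_i (M i)%:R * pw i.
  congr (- _); rewrite /E_index rmorphD rmorphM /= !rmorph_nat.
  rewrite [RHS](bigID (fun i : 'I_r => (i < k)%N)) /= !natr_sum mulr_sumr.
  congr (_ + _); first by apply: eq_bigr => i ik; rewrite /pw ik mulrC.
  under [RHS]eq_bigl do rewrite -leqNgt.
  by apply: eq_bigr => i; rewrite /pw leqNgt => /negPf ->; rewrite mulr1.
have -> : cpow (1 - t) (- \sum_i (M i)%:R * pw i)
    = \prod_i (cpow (1 - t) (pw i)) ^- M i.
  rewrite cpowNr prodfV; congr (_^-1).
  rewrite (big_morph (cpow (1 - t)) (@cpowDr R (1 - t)) (cpow0 (1 - t))).
  by apply: eq_bigr => i _; rewrite cpow_natM.
rewrite -big_split /=; apply: eq_bigr => i _.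
have -> : rescale k rho t w i = w i / cpow (1 - t) (pw i).
  by rewrite /rescale /pw; case: ifP => // _; rewrite cpow1.
by rewrite exprMn exprVn mulrAC.
Qed.

Lemma idx_le (P : nat) M : rho <= P%:R -> (0 < P)%N ->
  0 <= idx M <= (P * \sum_i M i)%N%:R.
Proof.
move=> rP P0; rewrite /E_index addr_ge0 ?mulr_ge0 ?ler0n //=.
rewrite [X in (P * X)%N](bigID (fun i : 'I_r => (i < k)%N)) /= mulnDr natrD.
apply: lerD; first by rewrite natrM ler_wpM2r ?ler0n.
rewrite ler_nat (eq_bigl (fun i : 'I_r => ~~ (i < k)%N)); last first.
  by move=> i; rewrite leqNgt.
exact: leq_pmull.
Qed.

(** Expansion of [(1 - u) ^ (- lambda) E(lambda; w / (1 - u) ^ ...)] around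
    [u = 0]: the term of index [nu] has become a multiple of
    [(1 - u) ^ (- lambda - nu)], whose binomial coefficients combine with
    [(lambda)_nu] into those of the terms of [E] at [lambda + m]. *)
Lemma E_local_expansion lambda w (P : nat) (d v K : R) :
  0 < v -> v < 1 -> rho <= P%:R -> (0 < P)%N -> (1 - v) ^- P <= d ->
  (forall M, poch_defined lambda (idx M)) ->
  (forall n, cube_sum (normc \o term lambda (fun i => d%:C * w i)) n <= K) ->
  exists c (L : R), [/\ abs_bounded (fun m => c m * v%:C ^+ m) L,
    forall m, csums (shell_sum (fun M =>
        pochn lambda m / m`!%:R * term (lambda + m%:R) w M)) (c m) &
    forall u, normc u <= v -> csums (fun m => c m * u ^+ m)
      (cpow (1 - u) (- lambda) *
       E k rho lambda beta gamma (rescale k rho u w))].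
Proof.
move=> v0 v1 rP P0 vd pd wK.
have d0 : 0 < d.
  by apply: lt_le_trans vd; rewrite invr_gt0 exprn_gt0 // subr_gt0.
pose B := (Num.truncn (normc lambda)).+1.
have aM M : normc (lambda + (idx M)%:C) <= (B + P * \sum_i M i)%N%:R.
  apply: le_trans (normcD_le _ _) _; rewrite natrD.
  have /andP[i0 iP] := idx_le M rP P0.
  by rewrite lerD // ?(ltW (truncnS_gt _)) // normc_real ger0_norm.
have gK n :
    cube_sum (fun M => normc (term lambda w M) * d ^+ (\sum_i M i)%N) n <= K.
  apply: le_trans (wK n); apply: le_cube_sum => M /=.
  have dw i : normc (w i) <= d^-1 * normc (d%:C * w i).
    by rewrite Normc.normcM normc_real gtr0_norm // mulKf // gt_eqF.
  have dV0 : 0 <= d^-1 by rewrite invr_ge0 ltW.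
  have := normc_E_term_le lambda M dV0 dw.
  by rewrite exprVn ler_pdivlMl ?exprn_gt0 // mulrC.
have [c [L [cL cP cE]]] := multi_binomial_exchange r_gt0 v0 v1 vd aM gK.
exists c, L; split=> // [m|u uv].
  apply: csums_ext (cP m) => n; apply: eq_shell_sum => M.
  by rewrite E_term_shift.
have [l [cl sl]] := cE u uv.
have u1 : normc u < 1 by apply: le_lt_trans v1.
suff -> : cpow (1 - u) (- lambda) *
    E k rho lambda beta gamma (rescale k rho u w) = l by [].
have -> : E k rho lambda beta gamma (rescale k rho u w)
    = (cpow (1 - u) (- lambda))^-1 * l.
  apply: E_cube_sum; apply: csums_ext (csumsZ _ sl) => n.
  rewrite -shell_sumZ; apply: eq_shell_sum => M.
  rewrite E_term_rescale // opprD cpowDr [term lambda w M * _]mulrCA.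
  by rewrite mulKf // cpow_neq0.
by rewrite mulVKf // cpow_neq0.
Qed.

End LocalExpansion.

(** * The rescaled function near a point *)

Section Continuation.
Variables (R : realType) (r k : nat) (rho : R).
Variables (lambda : R[i]) (beta gamma : 'I_r -> R[i]) (x : 'I_r -> R[i]).
Hypothesis (r_gt0 : (0 < r)%N) (rho_ge0 : 0 <= rho).
Implicit Types (t u z h : R[i]).

Local Notation normc := (@Normc.normc R).
Local Notation term := (fun lambda w => E_term k rho lambda beta gamma w).
Local Notation idx := (E_index k rho).

Lemma analytic_on_disc_scale (G : R[i] -> R[i]) t z (d : R) : 0 <= d ->
  normc t <= 1 -> analytic_on_disc G (t * z) d ->
  analytic_on_disc (fun w => G (t * w)) z d.
Proof.
move=> d0 t1 [c [K [cK cG]]]; exists (fun n => c n * t ^+ n), K.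
have td h : normc h <= d -> normc (t * h) <= d.
  move=> hd; rewrite Normc.normcM -[leRHS]mul1r.
  by rewrite ler_pM ?normc_ge0.
have nd : normc d%:C <= d by rewrite normc_real ger0_norm.
split=> [|h hd].
  apply: abs_bounded_le (pser_abs_bounded cK (td _ nd)) => n.
  by rewrite exprMn mulrA.
rewrite mulrDr; apply: csums_ext (cG _ (td _ hd)) => n.
by rewrite exprMn mulrA.
Qed.

Lemma rescale_comp t u : normc t < 1 -> normc u < 1 ->
  0 < complex.Re ((1 - t) * (1 - u)) ->
  rescale k rho (1 - (1 - t) * (1 - u)) x = rescale k rho u (rescale k rho t x).
Proof.
move=> t1 u1 re; apply/funext => i; rewrite /rescale subKr.
case: ifP => ik; rewrite -mulrA -invfM //.
by rewrite cpowMl ?Re_lt1.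
Qed.

(** Only the modulus of [1 - t] enters, because [rho] is real. *)
Lemma normc_rescale_le (P : nat) (v : R) t0 t i : v < 1 -> 0 <= v ->
  rho <= P%:R -> (0 < P)%N -> normc t0 < 1 -> normc t < 1 ->
  normc (1 - t) * (1 - v) <= normc (1 - t0) ->
  normc (rescale k rho t0 x i) <= (1 - v) ^- P * normc (rescale k rho t x i).
Proof.
move=> v1 v0 rP P0 t01 t1 tt0.
have q0 : 0 < 1 - v by rewrite subr_gt0.
have n0 : 0 < normc (1 - t0) by rewrite normc_gt0 Re_gt0_neq0 // Re_lt1.
have n1 : 0 < normc (1 - t) by rewrite normc_gt0 Re_gt0_neq0 // Re_lt1.
rewrite /rescale; case: ifP => ik; rewrite !Normc.normcM !Normc.normcV mulrCA;
  rewrite ler_wpM2l ?normc_ge0 // -invfM lef_pV2 ?posrE ?mulr_gt0 ?exprn_gt0 //;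
  rewrite ?normc_cpow_real ?expR_gt0 //; last first.
  apply: le_trans tt0; rewrite mulrC ler_wpM2l ?(ltW n1) //.
  have -> : P = P.-1.+1 by rewrite prednK.
  rewrite exprS -[leRHS]mulr1 ler_wpM2l ?(ltW q0) // exprn_ile1 ?(ltW q0) //.
  by rewrite lerBlDr lerDl.
have -> : (1 - v) ^+ P = expR (P%:R * ln (1 - v)).
  by rewrite expRM_natl lnK.
rewrite -expRD ler_expR.
have l0 : ln (1 - v) <= 0 by rewrite ln_le0 // lerBlDr lerDl.
apply: le_trans (_ : rho * (ln (normc (1 - t) * (1 - v))) <= _); last first.
  by rewrite ler_wpM2l // ler_ln ?posrE ?mulr_gt0.
rewrite lnM ?posrE // mulrDr addrC lerD2l.
by rewrite ler_wnM2r.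
Qed.

Definition rescaled_E t :=
  cpow (1 - t) (- lambda) * E k rho lambda beta gamma (rescale k rho t x).

(** Since [1 - (t0 + h)] is the product of [1 - t0] and [1 - h / (1 - t0)], the
    function near [t0] is its own expansion near 0 with [x] replaced by [x]
    rescaled at [t0]. Of the two factors [(1 - v) ^- P] of slack, one pays for
    passing from [t] to a point [t0] slightly closer to 1, the other for the
    expansion there. *)
Lemma rescaled_E_analytic (P : nat) (d v : R) t t0 (e : R) :
  0 < v -> v < 1 -> rho <= P%:R -> (0 < P)%N ->
  (1 - v) ^- P * (1 - v) ^- P <= d ->
  (forall M : 'I_r -> nat, poch_defined lambda (idx M)) ->
  normc t < 1 ->
  E_abs_cvg k rho lambda beta gamma (fun i => d%:C * rescale k rho t x i) ->
  normc (1 - t) * (1 - v) <= normc (1 - t0) ->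
  0 < e -> normc t0 + e < 1 -> e <= v * normc (1 - t0) ->
  analytic_on_disc rescaled_E t0 e.
Proof.
move=> v0 v1 rP P0 vd pd t1 tE tt0 e0 t0e ev.
have t01 : normc t0 < 1 by apply: le_lt_trans t0e; rewrite lerDl ltW.
have q0 : 0 < (1 - v) ^- P by rewrite invr_gt0 exprn_gt0 // subr_gt0.
have z0 : 1 - t0 != 0 by apply: Re_gt0_neq0; apply: Re_lt1.
have nz0 : 0 < normc (1 - t0) by rewrite normc_gt0.
have [K wK] : exists K, forall n, cube_sum (normc \o term lambda
    (fun i => ((1 - v) ^- P)%:C * rescale k rho t0 x i)) n <= K.
  apply: E_abs_cvg_le tE => i; rewrite !Normc.normcM !normc_real.
  have d0 : 0 <= d by apply: le_trans vd; rewrite mulr_ge0 // ltW.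
  rewrite (gtr0_norm q0) (ger0_norm d0).
  apply: le_trans (_ :
    (1 - v) ^- P * ((1 - v) ^- P * normc (rescale k rho t x i)) <= _).
    by rewrite ler_wpM2l ?(ltW q0) // normc_rescale_le // ltW.
  by rewrite mulrA ler_wpM2r ?normc_ge0.
have [c [L [cL _ cE]]] := E_local_expansion r_gt0 rho_ge0 v0 v1 rP P0
  (lexx _) pd wK.
pose C := cpow (1 - t0) (- lambda).
have uE h : normc h <= e -> normc (h / (1 - t0)) <= v.
  move=> he; rewrite Normc.normcM Normc.normcV ler_pdivrMr //.
  exact: le_trans he ev.
exists (fun m => C * (c m * (1 - t0) ^- m)), (normc C * L).
have CE h m :
    C * (c m * (1 - t0) ^- m) * h ^+ m = C * (c m * (h / (1 - t0)) ^+ m).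
  by rewrite exprMn exprVn; ring.
have ne : normc e%:C <= e by rewrite normc_real gtr0_norm.
split=> [|h he].
  apply: abs_bounded_le (abs_boundedZ C (pser_abs_bounded cL (uE _ ne))) => m.
  by rewrite CE.
have := csumsZ C (cE _ (uE _ he)).
set u := h / (1 - t0).
have u1 : normc u < 1 by apply: le_lt_trans v1; apply: uE.
have tuE : (1 - t0) * (1 - u) = 1 - (t0 + h).
  by rewrite /u mulrBr mulr1 mulrCA mulfV // mulr1; ring.
have th1 : normc (t0 + h) < 1.
  by apply: le_lt_trans t0e; apply: le_trans (normcD_le _ _) _; rewrite lerD2l.
have re : 0 < complex.Re ((1 - t0) * (1 - u)) by rewrite tuE; apply: Re_lt1.
have -> : C * (cpow (1 - u) (- lambda) *
    E k rho lambda beta gamma (rescale k rho u (rescale k rho t0 x)))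
    = rescaled_E (t0 + h).
  have e1 : rescale k rho (t0 + h) x = rescale k rho u (rescale k rho t0 x).
    by rewrite -(rescale_comp t01 u1 re) tuE subKr.
  have e2 : cpow (1 - (t0 + h)) (- lambda) = C * cpow (1 - u) (- lambda).
    rewrite -tuE; exact: cpowMl (Re_lt1 t01) (Re_lt1 u1) re.
  by rewrite /rescaled_E e1 e2 mulrA.
by apply: csums_ext => m; rewrite CE.
Qed.

(** Near the origin the expansion has the coefficients of the generating
    series. *)
Lemma rescaled_E_series (P : nat) (d v : R) :
  0 < v -> v < 1 -> rho <= P%:R -> (0 < P)%N -> (1 - v) ^- P <= d ->
  (forall n : nat, E_defined k rho (lambda + n%:R) beta gamma x) ->
  E_abs_cvg k rho lambda beta gamma (fun i => d%:C * x i) ->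
  exists L, abs_bounded (fun m => binom_coef lambda m *
      E k rho (lambda + m%:R) beta gamma x * v%:C ^+ m) L /\
  forall u, normc u <= v -> csums (fun m => binom_coef lambda m *
      E k rho (lambda + m%:R) beta gamma x * u ^+ m) (rescaled_E u).
Proof.
move=> v0 v1 rP P0 vd Edef dE.
have [_ pd _ _] := Edef 0%N; rewrite addr0 in pd.
have [K wK] := E_abs_cvg_bounded dE.
have [c [L [cL cP cE]]] := E_local_expansion r_gt0 rho_ge0 v0 v1 rP P0 vd pd wK.
have cm m : c m = binom_coef lambda m * E k rho (lambda + m%:R) beta gamma x.
  apply: csums_unique (cP m) _.
  have [_ _ _ [dm dm1 mE]] := Edef m.
  have [Km mK] : exists K, forall n,
      cube_sum (normc \o term (lambda + m%:R) x) n <= K.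
    apply: E_abs_cvg_le mE => i; rewrite Normc.normcM normc_real.
    rewrite gtr0_norm ?(lt_trans ltr01) // ler_peMl ?normc_ge0 // ltW //.
  apply: csums_ext (csumsZ (binom_coef lambda m) (E_csums r_gt0 mK)) => n.
  by rewrite -shell_sumZ.
exists L; split=> [|u uv].
  by apply: abs_bounded_le cL => m; rewrite cm.
by apply: csums_ext (cE u uv) => m; rewrite cm.
Qed.

End Continuation.

Section Path.
Variable R : realType.
Implicit Types (t z : R[i]).

Local Notation normc := (@Normc.normc R).
Local Notation Rec := (@complex.Re R).
Local Notation Imc := (@complex.Im R).

Lemma normc_sqr z : normc z ^+ 2 = Rec z ^+ 2 + Imc z ^+ 2.
Proof. by case: z => p q /=; rewrite sqr_sqrtr // addr_ge0 ?sqr_ge0. Qed.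

(** Along the chord of the circle through [t] centred at the origin that joins
    its point [- |t|] to [t], the distance to 1 decreases: at the end [t] the
    chord still makes an acute angle with the direction of 1. *)
Lemma chord_distance t (x : R) : normc t <= 1 -> 0 <= x <= 1 ->
  normc (1 - t) <= normc (1 - ((- normc t)%:C + x%:C * (t + (normc t)%:C))).
Proof.
move=> t1 /andP[x0 x1].
rewrite -(@ler_pXn2r _ 2) ?nnegrE ?normc_ge0 // !normc_sqr.
have n0 := normc_ge0 t; have nE := normc_sqr t.
have pn : - normc t <= Rec t.
  by have := Re_le_normc t; rewrite ler_norml => /andP[].
move: n0 nE pn t1; move: (normc t) => n; case: t => p q /= n0 nE pn t1.
have -> : (1 - (- n + (x * (p + n) - 0 * (q + 0)))) ^+ 2
    + (0 - (0 + (x * (q + 0) + 0 * (p + n)))) ^+ 2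
  = ((1 - p) + (1 - x) * (p + n)) ^+ 2 + (x * q) ^+ 2 by ring.
have -> : (x * q) ^+ 2 =
    q ^+ 2 - 2 * (1 - x) * q ^+ 2 + (1 - x) ^+ 2 * q ^+ 2 by ring.
have -> : q ^+ 2 = n ^+ 2 - p ^+ 2 by rewrite nE; ring.
have y0 : 0 <= 1 - x by lra.
have a0 : 0 <= (1 - x) * ((p + n) * (1 - n)).
  by rewrite !mulr_ge0 //; lra.
have b0 : 0 <= (1 - x) ^+ 2 * (q ^+ 2 + (p + n) ^+ 2).
  by rewrite mulr_ge0 ?addr_ge0 ?sqr_ge0.
have qE : q ^+ 2 = n ^+ 2 - p ^+ 2 by rewrite nE; ring.
rewrite qE in b0.
have -> : (0 - q) ^+ 2 = n ^+ 2 - p ^+ 2 by rewrite sub0r sqrrN.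
lra.
Qed.

End Path.

(** * Continuation of a factor of a Cauchy product *)

Section ProductContinuation.
Variable R : realType.
Implicit Types (t z h : R[i]) (a b c : nat -> R[i]).

Local Notation normc := (@Normc.normc R).

Lemma pser_analytic c l : csums c l -> exists f : R[i] -> R[i],
  (forall z, normc z < 1 -> csums (fun n => c n * z ^+ n) (f z)) /\
  forall (s e : R) z, 0 < e -> s + e < 1 -> normc z <= s ->
    analytic_on_disc f z e.
Proof.
move=> cl.
exists (fun z => limn (series (fun n => c n * z ^+ n) : nat -> R[i]^o)).
have cf z : normc z < 1 -> csums (fun n => c n * z ^+ n)
    (limn (series (fun n => c n * z ^+ n) : nat -> R[i]^o)).
  move=> z1; have [K cK] := pser_abs_bounded_lt1 cl (normc_ge0 z) z1.
  have [s cs] := abs_bounded_csums (pser_abs_bounded cK (lexx _)).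
  by rewrite (cvgc_lim cs).
split=> // s e z e0 se zs.
have se0 : 0 <= s + e by rewrite addr_ge0 ?(ltW e0) // (le_trans (normc_ge0 z)).
have [K cK] := pser_abs_bounded_lt1 cl se0 se.
apply: (pser_recenter e0 _ cK); first by rewrite lerD2r.
by move=> w ws; apply: cf; apply: le_lt_trans se.
Qed.

Lemma abel_limit_seq c l (f : R[i] -> R[i]) : csums c l ->
  (forall z, normc z < 1 -> csums (fun n => c n * z ^+ n) (f z)) ->
  ((fun n => f (1 - n.+1%:R^-1 : R)%:C) : nat -> R[i]^o) @ \oo --> (l : R[i]^o).
Proof.
move=> cl cf; apply/cvgc_normP => e e0.
have cf' (y : R) : 0 <= y -> y < 1 -> csums (fun n => c n * y%:C ^+ n) (f y%:C).
  by move=> y0 y1; apply: cf; rewrite normc_real ger0_norm.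
have [d d0 dP] := abel_limit cl cf' e0.
near=> n; apply: dP.
- by rewrite subr_ge0 invf_le1 ?ler1n ?ltr0n.
- by rewrite ltrBlDr ltrDl invr_gt0 ltr0n.
- by rewrite subKr; near: n; apply: near_infty_natSinv_lt (PosNum d0).
Unshelve. all: by end_near. Qed.

Lemma analytic_on_disc_cvg (F : R[i] -> R[i]) t (d : R) (w : nat -> R[i]) :
  0 < d -> analytic_on_disc F t d ->
  (w : nat -> R[i]^o) @ \oo --> (t : R[i]^o) ->
  ((fun n => F (w n)) : nat -> R[i]^o) @ \oo --> (F t : R[i]^o).
Proof.
move=> d0 [c [K [cK cF]]] /cvgc_normP wt; apply/cvgc_normP => e e0.
have K0 : 0 <= K by have := cK 0%N; rewrite big_ord0.
have c0 : c 0%N = F t.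
  have z : normc 0 <= d by rewrite Normc.normc0 ltW.
  have := cF 0 z; rewrite addr0 => H; apply: csums_unique H.
  have := @csums_finite R (fun n => c n * 0 ^+ n) 1.
  rewrite big_ord_recl big_ord0 addr0 /= expr0 mulr1; apply.
  by move=> [//|n] _; rewrite expr0n mulr0.
have q0 : 0 < e * d / (K + 1) by rewrite divr_gt0 ?mulr_gt0 // ltr_wpDl.
near=> n.
have wd : normc (w n - t) < d by near: n; apply: wt.
have we : normc (w n - t) < e * d / (K + 1) by near: n; apply: wt.
have := pser_near0 d0 cK (ltW wd) (cF _ (ltW wd)).
rewrite [t + _]addrC subrK c0 => /le_lt_trans; apply.
rewrite mulrAC ltr_pdivrMr //.
apply: le_lt_trans (_ : normc (w n - t) * (K + 1) < _); last first.
  by rewrite -ltr_pdivlMr // ltr_wpDl.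
by rewrite ler_wpM2l ?normc_ge0 // lerDl.
Unshelve. all: by end_near. Qed.

(** The continuation argument. If the series of the [b m * t ^+ m] converged
    absolutely this would be the Cauchy product; in general it may diverge, and
    only its product with the series of the [a l] is known to converge. As
    functions of [z], both power series [a] and [c] are analytic in the unit
    disc, [F (t z)] is analytic along a path from 0 to 1, and
    [c = a * F (t z)] holds near 0, hence along the path, hence in the limit
    [z -> 1]. The path must avoid the points where [t z] is close to 1, so it
    first runs away from 1 to [- |t|], and then along a chord. *)
Lemma product_by_continuation a b c (A C : R[i]) (F : R[i] -> R[i]) t
    (v d L : R) :
  normc t < 1 -> t != 0 -> 0 < v -> 0 < d ->
  csums a A -> csums c C ->
  (forall n, c n = \sum_(i < n.+1) a i * (b (n - i)%N * t ^+ (n - i))) ->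
  abs_bounded (fun n => b n * v%:C ^+ n) L ->
  (forall h, normc h <= v -> csums (fun n => b n * h ^+ n) (F h)) ->
  (forall t0, normc t0 <= normc t ->
     1 <= normc (1 - t0) \/ normc (1 - t) * (1 - v) <= normc (1 - t0) ->
     analytic_on_disc F t0 d) ->
  C = A * F t.
Proof.
move=> t1 t0 v0 d0 aA cC cE bL bF an.
have nt0 : 0 < normc t by rewrite normc_gt0.
have n1t : 0 < normc (1 - t) by rewrite normc_gt0 Re_gt0_neq0 // Re_lt1.
have [fa [faE fa_an]] := pser_analytic aA.
have [fc [fcE fc_an]] := pser_analytic cC.
pose G z := fc z - fa z * F (t * z).
have tv z : normc z <= v -> normc (t * z) <= v.
  move=> zv; rewrite Normc.normcM -[leRHS]mul1r.
  by rewrite ler_pM ?normc_ge0 // ltW.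
pose eps := Num.min v (1 / 2).
have eps0 : 0 < eps by rewrite lt_min v0 divr_gt0.
have G0 z : normc z < eps -> G (0 + z) = 0.
  rewrite add0r lt_min => /andP[zv z2].
  have z1 : normc z < 1 by lra.
  have [Ka aK] := pser_abs_bounded_lt1 aA (normc_ge0 z) z1.
  have aK' := pser_abs_bounded aK (lexx _).
  have bK' := pser_abs_bounded bL (tv z (ltW zv)).
  have [_ H] := csums_cauchy_product aK' bK' (faE z z1) (bF _ (tv z (ltW zv))).
  apply/eqP; rewrite subr_eq0; apply/eqP; apply: csums_unique (fcE z z1) _.
  apply: csums_ext H => n; rewrite cE mulr_suml; apply: eq_bigr => i _.
  have -> : z ^+ n = z ^+ i * z ^+ (n - i) by rewrite -exprD subnKC // -ltnS.
  by rewrite exprMn; ring.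
have Gs (s : R) : 0 <= s -> s < 1 -> 1 - s <= v * normc (1 - t) ->
    fc s%:C = fa s%:C * F (t * s%:C).
  move=> s0 s1 sv.
  pose e := Num.min d ((1 - s) / 2).
  have e0 : 0 < e by rewrite lt_min d0 divr_gt0 // subr_gt0.
  have se : s + e < 1.
    by have : e <= (1 - s) / 2 by [rewrite /e ge_min lexx orbT]; lra.
  pose tau := t * s%:C.
  have ntau : normc tau = normc t * s.
    by rewrite Normc.normcM normc_real ger0_norm.
  have ntau_t : normc tau <= normc t by rewrite ntau ler_piMr ?normc_ge0 // ltW.
  have tau1 : normc tau <= 1 by apply: le_trans ntau_t (ltW t1).
  have farther : normc (1 - t) * (1 - v) <= normc (1 - tau).
    have -> : 1 - t = (1 - tau) - (1 - s)%:C * t.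
      by rewrite /tau rmorphB rmorph1; ring.
    rewrite mulrBr mulr1 lerBlDr; apply: le_trans (normcB_le _ _) _.
    rewrite lerD2l Normc.normcM normc_real ger0_norm ?subr_ge0 ?(ltW s1) //.
    apply: le_trans (_ : 1 - s <= _).
      by rewrite ler_piMr ?subr_ge0 // ltW.
    have -> : 1 - tau - (1 - s)%:C * t = 1 - t.
      by rewrite /tau rmorphB rmorph1; ring.
    by rewrite mulrC.
  have anG z : normc z <= s ->
      1 <= normc (1 - t * z) \/ normc (1 - t) * (1 - v) <= normc (1 - t * z) ->
      analytic_on_disc G z e.
    move=> zs tz.
    have anF : analytic_on_disc (fun w => F (t * w)) z e.
      apply: analytic_on_disc_scale; rewrite ?(ltW e0) ?(ltW t1) //.
      have [c' [K [cK cF]]] : analytic_on_disc F (t * z) d.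
        apply: an tz; rewrite Normc.normcM ler_piMr ?normc_ge0 //.
        exact: le_trans zs (ltW s1).
      have ed : e <= d by rewrite /e ge_min lexx.
      exists c', K; split=> [|h he]; last by apply: cF; apply: le_trans ed.
      by apply: (pser_abs_bounded cK); rewrite normc_real gtr0_norm.
    apply: analytic_on_discB; first exact: fc_an e0 se zs.
    by apply: analytic_on_discM (ltW e0) _ anF; apply: fa_an e0 se zs.
  (* the turning point, where t z = - |t| s *)
  pose zm := (- normc tau)%:C / t.
  have tzm : t * zm = (- normc tau)%:C by rewrite /zm mulrCA mulfV // mulr1.
  have nzm : normc zm = s.
    rewrite /zm Normc.normcM Normc.normcV normc_real normrN.
    rewrite ger0_norm ?normc_ge0 //.
    by rewrite ntau mulrAC mulfV ?mul1r // gt_eqF.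
  have G1 h : normc h <= e -> G (zm + h) = 0.
    apply: (analytic_zero_segment e0 eps0 _ G0) => y /andP[y0 y1].
    rewrite add0r subr0; apply: anG.
      by rewrite Normc.normcM nzm normc_real ger0_norm // ler_piMl.
    left; have -> : 1 - t * (y%:C * zm) = (1 + y * normc tau)%:C.
      by rewrite mulrCA tzm rmorphD rmorph1 rmorphM rmorphN mulrN opprK.
    have yn : 0 <= y * normc tau by rewrite mulr_ge0 ?normc_ge0.
    by rewrite normc_real ger0_norm ?lerDl // addr_ge0.
  have G2 h : normc h <= e -> G (s%:C + h) = 0.
    have G1' z : normc z < e -> G (zm + z) = 0 by move=> /ltW; apply: G1.
    apply: (analytic_zero_segment e0 e0 _ G1') => y y01.
    have /andP[y0 y1] := y01.
    apply: anG.
      have -> : zm + y%:C * (s%:C - zm) = (1 - y)%:C * zm + y%:C * s%:C.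
        by rewrite rmorphB rmorph1; ring.
      apply: le_trans (normcD_le _ _) _.
      rewrite (Normc.normcM (1 - y)%:C) (Normc.normcM y%:C) nzm !normc_real.
      rewrite !ger0_norm ?subr_ge0 //.
      by rewrite -mulrDl subrK mul1r.
    right; apply: le_trans farther _.
    have -> : t * (zm + y%:C * (s%:C - zm))
        = (- normc tau)%:C + y%:C * (tau + (normc tau)%:C).
      have -> : t * (zm + y%:C * (s%:C - zm)) = t * zm + y%:C * (tau - t * zm).
        by rewrite /tau; ring.
      by rewrite tzm rmorphN opprK.
    exact: chord_distance.
  have n0e : normc 0 <= e by rewrite Normc.normc0 ltW.
  have := G2 0 n0e; rewrite addr0 /G => /eqP.
  by rewrite subr_eq0 => /eqP.
have Ft : ((fun n => F (t * (1 - n.+1%:R^-1 : R)%:C)) : nat -> R[i]^o) @ \oo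
    --> (F t : R[i]^o).
  have anFt : analytic_on_disc F t d.
    apply: (an t (lexx _)); right.
    by rewrite ler_piMr ?normc_ge0 // lerBlDr lerDl ltW.
  have s1 : ((fun n => (1 - n.+1%:R^-1 : R)%:C) : nat -> R[i]^o) @ \oo
      --> (1 : R[i]^o).
    apply/cvgc_normP => e e0; near=> n.
    rewrite rmorphB rmorph1 addrAC subrr add0r normc_opp normc_real.
    rewrite ger0_norm ?invr_ge0 ?ler0n //.
    by near: n; apply: near_infty_natSinv_lt (PosNum e0).
  have ts := cvgcM (cvgc_cst t) s1; rewrite mulr1 in ts.
  exact: analytic_on_disc_cvg d0 anFt ts.
have H := cvgcM (abel_limit_seq aA faE) Ft.
apply: cvgc_unique (abel_limit_seq cC fcE) _.
apply: (cvgc_near_eq _ H); near=> n.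
have n1 : 0 < n.+1%:R^-1 :> R by rewrite invr_gt0 ltr0n.
apply/esym; apply: Gs.
- by rewrite subr_ge0 invf_le1 ?ler1n ?ltr0n.
- by rewrite ltrBlDr ltrDl.
rewrite subKr; apply: ltW; near: n.
have vt : 0 < v * normc (1 - t) by rewrite mulr_gt0.
exact: near_infty_natSinv_lt (PosNum vt).
Unshelve. all: by end_near. Qed.

(** The coefficients of [A (z ^+ p)] when those of [A z] are [a]. *)
Definition spread (p : nat) a n : R[i] :=
  if (p %| n)%N then a (n %/ p)%N else 0.

Lemma sum_multiples (p n : nat) (f : nat -> R[i]) : (0 < p)%N ->
  \sum_(i < n.+1) (if (p %| i)%N then f i else 0)
  = \sum_(l < (n %/ p).+1) f (p * l)%N.
Proof.
move=> p0; elim: n => [|n IH].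
  by rewrite div0n !big_ord_recl !big_ord0 dvdn0 muln0.
rewrite big_ord_recr IH /= divnS //.
case: ifP => [pn|_]; last by rewrite addr0.
rewrite add1n [in RHS]big_ord_recr /=; congr (_ + f _).
by rewrite -[LHS](divnK pn) divnS // pn add1n mulnC.
Qed.

Lemma csums_spread (p : nat) a l : (0 < p)%N -> csums a l ->
  csums (spread p a) l.
Proof.
move=> p0 /csums_normP al; apply/csums_normP => e e0.
have [N _ NP] := al e e0; exists (p * N).+1 => // -[//|n] /= pN.
have -> : \sum_(i < n.+1) spread p a i = \sum_(i < (n %/ p).+1) a i.
  rewrite /spread (sum_multiples n (fun i => a (i %/ p)%N)) //.
  by apply: eq_bigr => i _; rewrite mulKn.
by apply: NP => /=; apply: leqW; rewrite leq_divRL // mulnC.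
Qed.

End ProductContinuation.

(** * The generating function *)

Lemma bernoulli_inequality (R : realDomainType) (v : R) n :
  0 <= v -> v <= 1 -> 1 - n%:R * v <= (1 - v) ^+ n.
Proof.
move=> v0 v1; elim: n => [|n IH]; first by rewrite mul0r subr0 expr0.
have n0 : 0 <= n%:R * (v * v) by rewrite !mulr_ge0 ?ler0n.
rewrite exprS; apply: le_trans (_ : (1 - v) * (1 - n%:R * v) <= _); last first.
  by rewrite ler_wpM2l // subr_ge0.
rewrite -natr1; lra.
Qed.

(** Bernoulli's inequality with exponent [2 P] shows that
    [v = (1 - 1 / d) / (2 P)] works. *)
Lemma geometric_slack (R : realType) (P : nat) (d : R) : (0 < P)%N -> 1 < d ->
  exists v : R, [/\ 0 < v, v < 1, (1 - v) ^- P <= d &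
    (1 - v) ^- P * (1 - v) ^- P <= d].
Proof.
move=> P0 d1; pose n : R := (P + P)%N%:R.
have n1 : 1 <= n by rewrite ler1n addn_gt0 P0.
have n0 : 0 < n by apply: lt_le_trans ltr01 n1.
have d0 : 0 < d by apply: lt_trans d1.
have dV : d^-1 < 1 by rewrite invf_lt1.
have dV0 : 0 < d^-1 by rewrite invr_gt0.
pose v := (1 - d^-1) / n.
have v0 : 0 < v by rewrite divr_gt0 // subr_gt0.
have v1 : v < 1 by rewrite ltr_pdivrMr // mul1r; lra.
have q0 : 0 < 1 - v by rewrite subr_gt0.
have main : (1 - v) ^- P * (1 - v) ^- P <= d.
  rewrite -invfM -exprD -[leRHS]invrK lef_pV2 ?posrE ?exprn_gt0 //.
  apply: le_trans (bernoulli_inequality (P + P) (ltW v0) (ltW v1)).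
  by rewrite -/n /v mulrC divfK ?gt_eqF //; lra.
exists v; split=> //; apply: le_trans main.
rewrite ler_peMl ?invr_ge0 ?exprn_ge0 ?(ltW q0) // invf_ge1 ?exprn_gt0 //.
by rewrite exprn_ile1 ?(ltW q0) // lerBlDr lerDl ltW.
Qed.

Lemma E_abs_cvg_smaller_dilation (R : realType) (r k : nat) (rho : R)
    (lambda : R[i]) (beta gamma w : 'I_r -> R[i]) (d e : R) :
  0 <= d -> d <= e ->
  E_abs_cvg k rho lambda beta gamma (fun i => e%:C * w i) ->
  E_abs_cvg k rho lambda beta gamma (fun i => d%:C * w i).
Proof.
move=> d0 de eE.
have [K dK] : exists K, forall n, cube_sum (@Normc.normc R \o
    E_term k rho lambda beta gamma (fun i => d%:C * w i)) n <= K.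
  apply: E_abs_cvg_le eE => i; rewrite !Normc.normcM ler_wpM2r ?normc_ge0 //.
  by rewrite !normc_real !ger0_norm // (le_trans d0).
apply: nondecreasing_is_cvgn; last by exists K => _ [n _ <-]; apply: dK.
apply/nondecreasing_seqP => n.
rewrite [leRHS](cube_sumS (@Normc.normc R \o _)) lerDl.
by apply: shell_sum_ge0 => M; apply: normc_ge0.
Qed.

(** The powers of [t ^+ p] hidden in the last argument of [Theta] cancel against
    [t ^+ n], leaving [t ^+ (n - p l)]. *)
Lemma Theta_cauchy_product (R : realType) (r k s : nat) (rho : R)
    (lambda mu psi : R[i]) (beta gamma : 'I_r -> R[i])
    (a : nat -> R[i]) (Omega : R[i] -> ('I_s -> R[i]) -> R[i])
    (p : nat) (x : 'I_r -> R[i]) (y : 'I_s -> R[i]) (eta t : R[i]) n :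
  (0 < p)%N -> t != 0 ->
  Theta k rho lambda beta gamma a Omega mu psi n p x y (eta / t ^+ p) * t ^+ n
  = \sum_(i < n.+1) spread p (Lambda_term a Omega mu psi y eta) i *
      (binom_coef lambda (n - i)%N * E k rho (lambda + (n - i)%:R) beta gamma x
       * t ^+ (n - i)).
Proof.
move=> p0 t0.
pose f i := Lambda_term a Omega mu psi y eta (i %/ p)%N *
  (binom_coef lambda (n - i)%N * E k rho (lambda + (n - i)%:R) beta gamma x
   * t ^+ (n - i)).
transitivity (\sum_(i < n.+1) (if (p %| i)%N then f i else 0)); last first.
  apply: eq_bigr => i _; rewrite /spread /f.
  by case: ifP => // _; rewrite mul0r.
rewrite sum_multiples // /Theta mulr_suml; apply: eq_bigr => l _.
rewrite /f mulKn // /Lambda_term /binom_coef.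
have pln : (p * l <= n)%N.
  by rewrite mulnC -leq_divRL // -ltnS.
have -> : t ^+ n = t ^+ (p * l) * t ^+ (n - p * l) by rewrite -exprD subnKC.
rewrite expr_div_n -exprM.
have tp0 : t ^+ (p * l) != 0 by rewrite expf_neq0.
have f0 : (n - p * l)`!%:R != 0 :> R[i] by rewrite pnatr_eq0 -lt0n fact_gt0.
by field; rewrite tp0 f0.
Qed.

Theorem theorem6 (R : realType) (r k s : nat) (rho : R)
    (lambda mu psi : R[i]) (beta gamma : 'I_r -> R[i])
    (a : nat -> R[i]) (Omega : R[i] -> ('I_s -> R[i]) -> R[i])
    (p : nat) (x : 'I_r -> R[i]) (y : 'I_s -> R[i]) (eta t : R[i]) :
  (0 < r)%N -> (k <= r)%N -> (0 < s)%N -> (0 < p)%N -> 0 <= rho ->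
  (forall nu : R[i], exists z : 'I_s -> R[i], Omega nu z <> 0) ->
  (forall l : nat, a l <> 0) ->
  `|t| < 1 -> t <> 0 ->
  (* existence of the left-hand member *)
  (forall n : nat, E_defined k rho (lambda + n%:R) beta gamma x) ->
  cvgn (series (fun n : nat =>
          Theta k rho lambda beta gamma a Omega mu psi n p x y (eta / t ^+ p)
          * t ^+ n) : nat -> R[i]^o) ->
  (* existence of the right-hand member *)
  cvgn (series (Lambda_term a Omega mu psi y eta) : nat -> R[i]^o) ->
  E_defined k rho lambda beta gamma (rescale k rho t x) ->
  limn (series (fun n : nat =>
          Theta k rho lambda beta gamma a Omega mu psi n p x y (eta / t ^+ p)
          * t ^+ n) : nat -> R[i]^o)
  = Lambda a Omega mu psi y eta * cpow (1 - t) (- lambda)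
    * E k rho lambda beta gamma (rescale k rho t x).
Proof.
move=> r0 _ _ p0 rho0 _ _ t1 tn0 Edef Lcvg Acvg [_ pd _ [dt dt1 Et]].
have {tn0} t0 : t != 0 by apply/eqP.
have {}t1 : Normc.normc t < 1 by rewrite -ltcR.
have [_ _ _ [dx dx1 Ex]] := Edef 0%N; rewrite addr0 in Ex.
pose P := (Num.truncn rho).+1.
have rP : rho <= P%:R by rewrite ltW // truncnS_gt.
pose d := Num.min dx dt.
have d1 : 1 < d by rewrite lt_min dx1.
have d0 : 0 <= d by rewrite ltW // (lt_trans ltr01).
have ddx : d <= dx by rewrite /d ge_min lexx.
have ddt : d <= dt by rewrite /d ge_min lexx orbT.
have {}Ex := E_abs_cvg_smaller_dilation d0 ddx Ex.
have {}Et := E_abs_cvg_smaller_dilation d0 ddt Et.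
have [v [v0 v1 vd vvd]] := geometric_slack (isT : (0 < P)%N) d1.
have [L [bL bF]] := rescaled_E_series r0 rho0 v0 v1 rP isT vd Edef Ex.
have n1t : 0 < 1 - Normc.normc t by rewrite subr_gt0.
pose e := v * (1 - Normc.normc t).
have e0 : 0 < e by rewrite mulr_gt0.
have analytic t0' : Normc.normc t0' <= Normc.normc t ->
    1 <= Normc.normc (1 - t0') \/
    Normc.normc (1 - t) * (1 - v) <= Normc.normc (1 - t0') ->
    analytic_on_disc (rescaled_E k rho lambda beta gamma x) t0' e.
  move=> t0t far.
  have te : Normc.normc t0' + e < 1.
    have : e < 1 - Normc.normc t by rewrite /e gtr_pMl.
    by lra.
  have ev : e <= v * Normc.normc (1 - t0').
    rewrite ler_wpM2l ?(ltW v0) //.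
    have := normcD_le (1 - t0') t0'; rewrite subrK Normc.normc1.
    by lra.
  have analytic_from t' : Normc.normc t' < 1 ->
      E_abs_cvg k rho lambda beta gamma
        (fun i => d%:C * rescale k rho t' x i) ->
      Normc.normc (1 - t') * (1 - v) <= Normc.normc (1 - t0') ->
      analytic_on_disc (rescaled_E k rho lambda beta gamma x) t0' e.
    move=> t'1 t'E far'.
    exact: (rescaled_E_analytic r0 rho0 v0 v1 rP isT vvd pd t'1 t'E far'
      e0 te ev).
  (* far from 1 the point is compared with the origin, where the given series
     at [x] converges, and otherwise with [t] *)
  case: far => [far|far]; last exact: analytic_from far.
  apply: (analytic_from 0).
  - by rewrite Normc.normc0 ltr01.
  - have x0 : rescale k rho 0 x = x.
      apply/funext => i; rewrite /rescale subr0 divr1.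
      case: ifP => // _; have -> : cpow 1 rho%:C = 1 :> R[i].
        by rewrite /cpow clog1 mulr0 cexp0.
      by rewrite divr1.
    by rewrite x0; exact: Ex.
  - rewrite subr0 Normc.normc1 mul1r; apply: le_trans far.
    by rewrite lerBlDr lerDl ltW.
have := product_by_continuation t1 t0 v0 e0 (csums_spread p0 Acvg) Lcvg _
  bL bF analytic.
move=> ->; first by rewrite /rescaled_E mulrA.
by move=> n; apply: Theta_cauchy_product.
Qed.
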